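(* Let $p$ be a prime and let $\mathbf F$ be a non-abelian free pro-$p$ group of finite rank. Then the group $\mathrm{Comm}(\mathbf F)$ is monolithic, its monolith $\mathrm{Mon}(\mathrm{Comm}(\mathbf F))$ contains $\mathbf F$, and $\mathrm{Mon}(\mathrm{Comm}(\mathbf F))$ is abstractly simple.
   Context: For a profinite group $G$, $\mathrm{Comm}(G)$ is the group of equivalence classes $[f]$ of topological group isomorphisms $f:U\to V$ between open subgroups of $G$, where two such isomorphisms are equivalent if they coincide on some open subgroup of $G$, with product $[f_1][f_2]=[f_1\circ f_2]$ (for $f_i:U_i\to V_i$, the composition is defined on $f_2^{-1}(V_2\cap U_1)$). Each $g\in G$ gives the class of the conjugation $x\mapsto gxg^{-1}$; for $G=\mathbf F$ the resulting homomorphism $\mathbf F\to\mathrm{Comm}(\mathbf F)$ is injective, and $\mathbf F$ is identified with its image. An (abstract) group $\Gamma$ is monolithic if the intersection of all its non-trivial normal subgroups is non-trivial; this intersection is then called the monolith of $\Gamma$ and denoted $\mathrm{Mon}(\Gamma)$. ''Abstractly simple'' means simple as an abstract group; the normal subgroups in the definition of the monolith are not required to be closed. *)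

(* Defs.v *)
From HB Require Import structures.
From mathcomp Require Import all_boot generic_quotient.
From mathcomp Require Import boolp classical_sets functions cardinality topology.

Set Implicit Arguments.
Unset Strict Implicit.
Unset Printing Implicit Defensive.

Local Open Scope quotient_scope.
Local Open Scope classical_set_scope.
Local Open Scope group_scope.

HB.mixin Record isTopologicalGroup G of Topological G & Group G := {
  mulg_continuous : continuous (fun xy : G * G => xy.1 * xy.2);
  invg_continuous : continuous (fun x : G => x^-1)
}.

#[short(type="topologicalGroupType")]
HB.structure Definition TopologicalGroup :=
  {G of Topological G & Group G & isTopologicalGroup G}.

Section Subgroups.
Variable G : groupType.
Implicit Types H N M : set G.

Definition is_subgroup H : Prop :=
  [/\ H 1, forall x y, H x -> H y -> H (x * y) & forall x, H x -> H x^-1].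

Definition is_normal_in N M : Prop :=
  [/\ is_subgroup N, N `<=` M & forall g x, M g -> N x -> N (g * x * g^-1)].

Definition is_normal N : Prop := is_normal_in N [set: G].

Definition left_cosets H : set (set G) := range (fun g => [set g * h | h in H]).

(* The intersection of an empty family is the whole group, so the trivial group
   is not monolithic. *)
Definition monolith : set G :=
  \bigcap_(N in [set N | is_normal N /\ N <> [set 1]]) N.

End Subgroups.

Arguments monolith : clear implicits.

Definition monolithic (G : groupType) : Prop := monolith G <> [set 1].

(* Simplicity of a subgroup M as an abstract group: the ambient group only
   provides the multiplication. *)
Definition abstractly_simple (G : groupType) (M : set G) : Prop :=
  [/\ is_subgroup M, M <> [set 1] &
      forall N, is_normal_in N M -> N = [set 1] \/ N = M].

Definition open_subgroup (G : topologicalGroupType) (U : set G) : Prop :=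
  is_subgroup U /\ open U.

Definition profinite (G : topologicalGroupType) : Prop :=
  [/\ compact [set: G], hausdorff_space G & totally_disconnected [set: G]].

Definition pro_p (p : nat) (G : topologicalGroupType) : Prop :=
  profinite G /\
  forall N : set G, is_normal N -> open N ->
    exists k : nat, (left_cosets N #= `I_(p ^ k)%N)%card.

Definition continuous_morphism (G H : topologicalGroupType) (phi : G -> H)
    : Prop :=
  {morph phi : x y / x * y} /\ continuous phi.

Definition free_pro_p_basis (p : nat) (F : topologicalGroupType) (n : nat)
    (x : 'I_n -> F) : Prop :=
  pro_p p F /\
  forall (P : topologicalGroupType) (y : 'I_n -> P), pro_p p P ->
    exists! phi : F -> P,
      continuous_morphism phi /\ forall i, phi (x i) = y i.

Definition free_pro_p_of_finite_rank (p : nat) (F : topologicalGroupType)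
    : Prop :=
  exists (n : nat) (x : 'I_n -> F), free_pro_p_basis p x.

(* A topological isomorphism dom -> cod between open subgroups of G. The maps
   are total on G for convenience; their values outside dom and cod are
   irrelevant and are identified by germ_eq below. *)
Record local_iso (G : topologicalGroupType) := LocalIso {
  dom : set G;
  cod : set G;
  fwd : G -> G;
  bwd : G -> G;
  dom_open_subgroup : open_subgroup dom;
  cod_open_subgroup : open_subgroup cod;
  fwd_cod : forall x, dom x -> cod (fwd x);
  bwd_dom : forall y, cod y -> dom (bwd y);
  fwdK : forall x, dom x -> bwd (fwd x) = x;
  bwdK : forall y, cod y -> fwd (bwd y) = y;
  fwdM : forall x y, dom x -> dom y -> fwd (x * y) = fwd x * fwd y;
  fwd_continuous : {within dom, continuous fwd};
  bwd_continuous : {within cod, continuous bwd}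
}.

HB.instance Definition _ (G : topologicalGroupType) :=
  gen_eqMixin (local_iso G).
HB.instance Definition _ (G : topologicalGroupType) :=
  gen_choiceMixin (local_iso G).

Section LocalIso.
Variable G : topologicalGroupType.
Implicit Types (f g h : local_iso G) (U V W : set G).

Definition germ_eq f g : Prop :=
  exists W, [/\ open_subgroup W, W `<=` dom f `&` dom g &
                forall x, W x -> fwd f x = fwd g x].

Lemma open_subgroupT : open_subgroup [set: G].
Proof. by split; [split | exact: openT]. Qed.

Lemma open_subgroupI U V :
  open_subgroup U -> open_subgroup V -> open_subgroup (U `&` V).
Proof.
move=> [[U1 UM UV] oU] [[V1 VM VV] oV]; split; last exact: openI.
split; first by [].
  by move=> x y [? ?] [? ?]; split; [exact: UM | exact: VM].
by move=> x [? ?]; split; [exact: UV | exact: VV].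
Qed.

Lemma bwdM f x y : cod f x -> cod f y -> bwd f (x * y) = bwd f x * bwd f y.
Proof.
move=> fx fy; have [[_ dM _] _] := dom_open_subgroup f.
rewrite -{1}(bwdK fx) -{1}(bwdK fy) -fwdM ?fwdK//; do ?exact: bwd_dom.
by apply: dM; exact: bwd_dom.
Qed.

Lemma fwd1 f : fwd f 1 = 1.
Proof.
have [[d1 _ _] _] := dom_open_subgroup f.
by apply: (@mulgI _ (fwd f 1)); rewrite -fwdM// !mulg1.
Qed.

Lemma fwdV f x : dom f x -> fwd f x^-1 = (fwd f x)^-1.
Proof.
have [[d1 _ dV] _] := dom_open_subgroup f.
move=> dx; apply: (@mulgI _ (fwd f x)).
by rewrite -fwdM ?mulgV ?fwd1//; exact: dV.
Qed.

Lemma preimage_open_subgroup f W :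
  open_subgroup W -> open_subgroup (dom f `&` fwd f @^-1` W).
Proof.
move=> [[W1 WM WV] oW].
have [[d1 dM dV] od] := dom_open_subgroup f; split.
- split.
  + by split => //=; rewrite fwd1.
  + move=> x y [dx Wx] [dy Wy]; split; first exact: dM.
    by rewrite /= fwdM//; exact: WM.
  + move=> x [dx Wx]; split; first exact: dV.
    by rewrite /= fwdV//; exact: WV.
- have fc : {within dom f, continuous (fwd f)} by exact: fwd_continuous.
  rewrite continuous_open_subspace// in fc.
  by move/(continuous_inP _ od): fc; apply.
Qed.

Lemma within_comp U V (u v : G -> G) : open U -> open V ->
  {within U, continuous u} -> {within V, continuous v} ->
  {within U `&` u @^-1` V, continuous (v \o u)}.
Proof.
move=> oU oV.
rewrite (continuous_open_subspace u oU) (continuous_open_subspace v oV).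
move=> /(continuous_inP _ oU) cu /(continuous_inP _ oV) cv.
have oUV := cu _ oV; rewrite (continuous_open_subspace _ oUV).
apply/(continuous_inP _ oUV) => X /cv /cu.
by rewrite preimage_setI setIA comp_preimage.
Qed.

Lemma local_iso_id_subproof : {within [set: G], continuous (@id G)}.
Proof. by apply: continuous_subspaceT => x; exact: cvg_id. Qed.

Definition local_iso_id : local_iso G :=
  @LocalIso G setT setT id id open_subgroupT open_subgroupT
    (fun _ => id) (fun _ => id) (fun _ _ => erefl) (fun _ _ => erefl)
    (fun _ _ _ _ => erefl) local_iso_id_subproof local_iso_id_subproof.

Definition local_iso_inv f : local_iso G :=
  @LocalIso G (cod f) (dom f) (bwd f) (fwd f)
    (cod_open_subgroup f) (dom_open_subgroup f)
    (@bwd_dom _ f) (@fwd_cod _ f) (@bwdK _ f) (@fwdK _ f) (@bwdM f)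
    (@bwd_continuous _ f) (@fwd_continuous _ f).

Section Comp.
Variables f g : local_iso G.

Let D := dom g `&` fwd g @^-1` dom f.
Let C := cod f `&` bwd f @^-1` cod g.

Lemma comp_dom_subproof : open_subgroup D.
Proof. exact/preimage_open_subgroup/dom_open_subgroup. Qed.

Lemma comp_cod_subproof : open_subgroup C.
Proof.
exact: (@preimage_open_subgroup (local_iso_inv f) _ (cod_open_subgroup g)).
Qed.

Lemma comp_fwd_cod x : D x -> C ((fwd f \o fwd g) x).
Proof.
move=> [gx fgx]; split; first exact: fwd_cod.
by rewrite /= fwdK//; exact: fwd_cod.
Qed.

Lemma comp_bwd_dom y : C y -> D ((bwd g \o bwd f) y).
Proof.
move=> [fy gfy]; split; first exact: bwd_dom.
by rewrite /= bwdK//; exact: bwd_dom.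
Qed.

Lemma comp_fwdK x : D x -> (bwd g \o bwd f) ((fwd f \o fwd g) x) = x.
Proof. by move=> [gx fgx]; rewrite /= !fwdK. Qed.

Lemma comp_bwdK y : C y -> (fwd f \o fwd g) ((bwd g \o bwd f) y) = y.
Proof. by move=> [fy gfy]; rewrite /= !bwdK. Qed.

Lemma comp_fwdM x y : D x -> D y ->
  (fwd f \o fwd g) (x * y) = (fwd f \o fwd g) x * (fwd f \o fwd g) y.
Proof. by move=> [? ?] [? ?]; rewrite /= !fwdM. Qed.

Lemma comp_fwd_continuous : {within D, continuous (fwd f \o fwd g)}.
Proof.
apply: within_comp; [exact: (dom_open_subgroup g).2 |
  exact: (dom_open_subgroup f).2 | exact: fwd_continuous |
  exact: fwd_continuous].
Qed.

Lemma comp_bwd_continuous : {within C, continuous (bwd g \o bwd f)}.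
Proof.
apply: within_comp; [exact: (cod_open_subgroup f).2 |
  exact: (cod_open_subgroup g).2 | exact: bwd_continuous |
  exact: bwd_continuous].
Qed.

Definition local_iso_comp : local_iso G :=
  LocalIso comp_dom_subproof comp_cod_subproof comp_fwd_cod comp_bwd_dom
    comp_fwdK comp_bwdK comp_fwdM comp_fwd_continuous comp_bwd_continuous.

End Comp.

Lemma germ_eq_refl f : germ_eq f f.
Proof. by exists (dom f); split => //; exact: dom_open_subgroup. Qed.

Lemma germ_eq_sym f g : germ_eq f g -> germ_eq g f.
Proof.
by move=> [W [oW Wfg fg]]; exists W; split=> //;
  [rewrite setIC | move=> x /fg].
Qed.

Lemma germ_eq_trans f g h : germ_eq f g -> germ_eq g h -> germ_eq f h.
Proof.
move=> [W [oW Wfg fg]] [W' [oW' Wgh gh]]; exists (W `&` W'); split.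
- exact: open_subgroupI.
- by move=> x [/Wfg[? _] /Wgh[_ ?]].
- by move=> x [Wx W'x]; rewrite fg// gh.
Qed.

Lemma germ_eq_comp f f' g g' : germ_eq f f' -> germ_eq g g' ->
  germ_eq (local_iso_comp f g) (local_iso_comp f' g').
Proof.
move=> [W [oW Wff' ff']] [V [oV Vgg' gg']].
exists (V `&` (dom g `&` fwd g @^-1` W)); split.
- exact/(open_subgroupI oV)/preimage_open_subgroup.
- move=> x [Vx [gx Wgx]]; have [? ?] := Vgg' _ Vx; have [? ?] := Wff' _ Wgx.
  by split; split=> //=; rewrite -gg'.
- by move=> x [Vx [gx Wgx]]; rewrite /= -gg'// ff'.
Qed.

Lemma germ_eq_inv f f' : germ_eq f f' ->
  germ_eq (local_iso_inv f) (local_iso_inv f').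
Proof.
move=> [W [oW Wff' ff']]; exists (cod f `&` bwd f @^-1` W).
have E y : cod f y -> W (bwd f y) -> cod f' y /\ bwd f y = bwd f' y.
  move=> fy Wy; have [_ f'y] := Wff' _ Wy.
  have yE : y = fwd f' (bwd f y) by rewrite -ff'// bwdK.
  have f'K : bwd f' y = bwd f y by rewrite {1}yE fwdK.
  by split; [rewrite yE; exact: fwd_cod | rewrite f'K].
split.
- exact: (@preimage_open_subgroup (local_iso_inv f)).
- by move=> y [fy Wy]; split=> //=; have [] := E _ fy Wy.
- by move=> y [fy Wy]; have [] := E _ fy Wy.
Qed.

Lemma germ_eqb_equiv : equiv_class_of (fun f g => `[< germ_eq f g >]).
Proof.
split.
- by move=> f; apply/asboolP; exact: germ_eq_refl.
- by move=> f g; apply/asboolP/asboolP; exact: germ_eq_sym.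
- move=> g f h /asboolP fg /asboolP gh; apply/asboolP.
  exact: germ_eq_trans fg gh.
Qed.

Definition germ_equiv : equiv_rel (local_iso G) := EquivRelPack germ_eqb_equiv.

Definition Comm : Type := {eq_quot germ_equiv}.

HB.instance Definition _ := Choice.on Comm.
HB.instance Definition _ := Quotient.on Comm.

Definition comm_class f : Comm := \pi_Comm f.

Lemma comm_classP f g : comm_class f = comm_class g <-> germ_eq f g.
Proof.
split; first by move=> /eqmodP /asboolP.
by move=> fg; apply/eqmodP/asboolP.
Qed.

Lemma comm_class_repr (a : Comm) : comm_class (repr a) = a.
Proof. exact: reprK. Qed.

Definition comm_one : Comm := comm_class local_iso_id.

Definition comm_mul (a b : Comm) : Comm :=
  comm_class (local_iso_comp (repr a) (repr b)).

Definition comm_inv (a : Comm) : Comm := comm_class (local_iso_inv (repr a)).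

Lemma comm_mulE f g :
  comm_mul (comm_class f) (comm_class g) = comm_class (local_iso_comp f g).
Proof.
by apply/comm_classP/germ_eq_comp; apply/comm_classP; exact: comm_class_repr.
Qed.

Lemma comm_invE f : comm_inv (comm_class f) = comm_class (local_iso_inv f).
Proof.
by apply/comm_classP/germ_eq_inv; apply/comm_classP; exact: comm_class_repr.
Qed.

Lemma comm_mulA : associative comm_mul.
Proof.
move=> a b c; rewrite -(comm_class_repr a) -(comm_class_repr b).
rewrite -(comm_class_repr c) !comm_mulE; apply/comm_classP.
set f := repr a; set g := repr b; set h := repr c.
exists (dom (local_iso_comp f (local_iso_comp g h))); split=> //.
  exact: dom_open_subgroup.
by move=> x [[hx ghx] fghx].
Qed.

Lemma comm_mul1 : left_id comm_one comm_mul.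
Proof.
move=> a; rewrite -(comm_class_repr a) comm_mulE; apply/comm_classP.
by exists (dom (repr a)); split=> //; exact: dom_open_subgroup.
Qed.

Lemma comm_1mul : right_id comm_one comm_mul.
Proof.
move=> a; rewrite -(comm_class_repr a) comm_mulE; apply/comm_classP.
by exists (dom (repr a)); split=> //; exact: dom_open_subgroup.
Qed.

Lemma comm_mulV : left_inverse comm_one comm_inv comm_mul.
Proof.
move=> a; rewrite -(comm_class_repr a) comm_invE comm_mulE; apply/comm_classP.
exists (dom (repr a)); split; first exact: dom_open_subgroup.
  by move=> x ax; split=> //; split=> //; exact: fwd_cod.
by move=> x ax /=; rewrite fwdK.
Qed.

Lemma comm_Vmul : right_inverse comm_one comm_inv comm_mul.
Proof.
move=> a; rewrite -(comm_class_repr a) comm_invE comm_mulE; apply/comm_classP.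
exists (cod (repr a)); split; first exact: cod_open_subgroup.
  by move=> x ax; split=> //; split=> //; exact: bwd_dom.
by move=> x ax /=; rewrite bwdK.
Qed.

HB.instance Definition _ := isGroup.Build Comm
  comm_mulA comm_mul1 comm_1mul comm_mulV comm_Vmul.

Definition conj_by (g x : G) : G := g * x * g^-1.

Lemma conj_continuous (g : G) : continuous (conj_by g).
Proof.
move=> x.
have mulc (u v : G -> G) : {for x, continuous u} -> {for x, continuous v} ->
    {for x, continuous (fun y => u y * v y)}.
  move=> cu cv.
  exact: (@continuous2_cvg _ _ _ _ _ _ u v (fun s t => s * t) (u x) (v x)
    (@mulg_continuous G (u x, v x)) cu cv).
apply: (mulc (fun y => g * y) (fun=> g^-1)); last exact: cvg_cst.
by apply: (mulc (fun=> g) id); [exact: cvg_cst | exact: cvg_id].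
Qed.

Section Conj.
Variable g : G.

Lemma conjVK (x : G) : setT x -> conj_by g^-1 (conj_by g x) = x.
Proof. by rewrite /conj_by invgK !mulgA mulVg mul1g mulgVK. Qed.

Lemma conjKV (x : G) : setT x -> conj_by g (conj_by g^-1 x) = x.
Proof. by rewrite /conj_by invgK !mulgA mulgV mul1g mulgK. Qed.

Lemma conj_morph (x y : G) : setT x -> setT y ->
  conj_by g (x * y) = conj_by g x * conj_by g y.
Proof. by rewrite /conj_by !mulgA mulgVK. Qed.

Lemma conj_within_continuous (h : G) :
  {within [set: G], continuous (conj_by h)}.
Proof. exact/continuous_subspaceT/conj_continuous. Qed.

Definition conj_iso : local_iso G :=
  @LocalIso G setT setT (conj_by g) (conj_by g^-1)
    open_subgroupT open_subgroupT (fun _ => id) (fun _ => id) conjVK conjKV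
    conj_morph (@conj_within_continuous g) (@conj_within_continuous g^-1).

End Conj.

Definition inner (g : G) : Comm := comm_class (conj_iso g).

Lemma innerM (g h : G) : inner (g * h) = inner g * inner h.
Proof.
rewrite [RHS]comm_mulE; apply/comm_classP; exists setT.
split=> //; first exact: open_subgroupT.
by move=> x _; rewrite /= /conj_by invgM !mulgA.
Qed.

End LocalIso.

Arguments Comm G : clear implicits.

(* Main.v *)
From HB Require Import structures.
From mathcomp Require Import all_boot all_fingroup all_solvable all_algebra.
From mathcomp Require Import boolp classical_sets functions cardinality topology.
Require Import Defs.

(** Let C be the commensurator of the free pro-p group F, and call a subgroup of C
    absorbing when all conjugates of F in C normalise it. The theorem reduces to
    one statement, [absorbing_contains_inner]: a nontrivial absorbing subgroup K
    contains F. Indeed normal subgroups of C are absorbing, so the monolith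
    contains F and is nontrivial ([inner_nontrivial]). It follows that a nontrivial
    normal subgroup N of the monolith is absorbing, as are its conjugates in C; all
    of these contain F, so their intersection is a nontrivial normal subgroup of C,
    and N contains the monolith.

    To see that K contains F, start from a nontrivial element k of K: the
    commutators of k with elements of F give a nontrivial x in K and F. Some
    open subgroup T contains x outside its Frattini subgroup
    ([nontrivial_character]), and T is free of rank at least two
    ([open_has_basis]), so x is part of a basis of T ([basis_adapt]). Let t be
    another element of such a basis, and let W be the kernel of the coordinate of
    t, of index p in T. Its Schreier basis ([schreier_basis]) contains x and
    t x t^-1, two elements conjugate under F. Two bases of W indexed by the same
    set are exchanged by an automorphism of W ([basis_automorphism]), that is, by
    an element of C; since C permutes the absorbing subgroups, K cannot separate
    one element of the Schreier basis from another, nor from any element that can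
    replace one of them in a basis ([linked_basis_all], [linked_basis_absorbed]).
    Hence K contains W. The other members of the same Schreier basis, in
    particular the p-th power of t, allow K to climb from a subgroup of index p
    to the whole group ([absorbing_step]), and so from W to F along a chain of
    subgroups each of index p in the next ([open_subgroup_up]).

    Freeness of open subgroups is tested on finite p-groups only. A family b is a
    basis of T when, for each finite p-group P, evaluation at b is a bijection
    from the homomorphisms T -> P to the families in P. Counting then shows that a
    generating family with the same index set as a basis is a basis
    ([basis_of_generates]), Schreier's theorem becomes the correspondence between
    homomorphisms from a subgroup of index p to P and homomorphisms to a wreath
    product, and automorphisms are obtained from their finite reductions by
    compactness ([endomorphism_ex]). *)

Set Implicit Arguments.
Unset Strict Implicit.
Unset Printing Implicit Defensive.

Local Open Scope classical_set_scope.
Local Open Scope group_scope.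

(** * Open normal subgroups of profinite groups *)

Section CompactTotallyDisconnected.
Variable T : topologicalType.
Hypotheses (cT : compact [set: T]) (hT : hausdorff_space T).

Let quasi x : set T := \bigcap_(C in [set C | clopen C /\ C x]) C.

(** The clopen neighbourhoods of [x] form a filter base with intersection
    [quasi x], so by compactness of the complement of [O] one of them misses
    that complement. *)
Let clopen_sub_open x (O : set T) : open O -> quasi x `<=` O ->
  exists C, [/\ clopen C, C x & C `<=` O].
Proof.
move=> oO qO.
pose D := [set C : set T | clopen C /\ C x].
pose FF := filter_from D id.
have FFF : ProperFilter FF.
  apply: filter_from_proper; last by move=> C [_ Cx]; exists x.
  apply: filter_from_filter; first by exists setT; split => //; exact: clopenT.
  move=> A B [cA Ax] [cB Bx]; exists (A `&` B) => //.
  by split=> //; exact: clopenI.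
apply: contrapT => nC.
have /(iffLR (compact_near_coveringP _)) : compact (~` O).
  by apply: (subclosed_compact _ cT) => //; exact: open_closedC.
move=> /(_ _ _ setC (powerset_filter_from_filter FFF))[].
  move=> y nOy.
  have [C [DC Cy]] : exists C, D C /\ ~ C y.
    apply: contrapT => nD; apply: nOy; apply: qO => C DC.
    by apply: contrapT => nCy; apply: nD; exists C.
  exists (~` C, [set U | U `<=` C]); first split.
  - apply: open_nbhs_nbhs; split => //; apply: closed_openC.
    by case: DC => -[].
  - apply/near_powerset_filter_fromP; first by move=> ? ?; exact: subset_trans.
    by exists C => //; exists C.
  - by case=> i j [? /subsetC]; apply.
move=> E [EF _ [B EB]] /(_ _ EB)/subsetC2 BO.
have [C [cC Cx] CB] := EF _ EB.
by apply: nC; exists C; split => //; exact: subset_trans BO.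
Qed.

(** Quasi-components are connected: a splitting of [quasi x] into two closed
    pieces is separated by disjoint open sets, and a clopen neighbourhood of [x]
    inside their union is cut by either of them in a clopen set, which must then
    contain all of [quasi x]. *)
Lemma totally_disconnected_zero_dimensional :
  totally_disconnected [set: T] -> zero_dimensional T.
Proof.
move=> tdT x y xy.
apply: contrapT => nC.
have qy : quasi x y.
  by move=> C [cC Cx]; apply: contrapT => Cy; apply: nC; exists C.
have clq : closed (quasi x) by apply: closed_bigI => C [[]].
have qx : quasi x x by move=> C [].
suff cq : connected (quasi x).
  have : connected_component [set: T] x y by exists (quasi x).
  by rewrite tdT// => /= yx; move: xy; rewrite yx eqxx.
move=> B [b Bb] [C oC BC] [D cD BD].
have clB : closed B by rewrite BD; exact: closedI.
pose A := quasi x `&` ~` C.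
have clA : closed A by apply: closedI => //; exact: open_closedC.
have BA : set_nbhs B (~` A).
  apply/set_nbhsP; exists (~` A); split => //; first exact: closed_openC.
  by move=> z; rewrite BC => -[_ Cz] [_].
have [P /set_nbhsP[U [oU BU UP]] PA] := compact_normal hT cT clB BA.
have oV : open (~` closure P) by apply: closed_openC; exact: closed_closure.
have UV z : U z -> ~ (~` closure P) z by move=> /UP/subset_closure Pz; apply.
have [K [[oK cK] Kx KUV]] : exists K, [/\ clopen K, K x & K `<=` U `|` ~` closure P].
  apply: clopen_sub_open; first exact: openU.
  move=> z qz; have [Cz|nCz] := pselect (C z).
    by left; apply: BU; rewrite BC.
  by right => /PA; apply.
have clo (O1 O2 : set T) : open O1 -> open O2 -> (forall z, O1 z -> ~ O2 z) ->
    K `<=` O1 `|` O2 -> O1 x -> quasi x `<=` O1.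
  move=> oO1 oO2 O12 KO O1x z qz; have [//] : (K `&` O1) z.
  apply: qz; split => //; split; first exact: openI.
  have -> : K `&` O1 = K `&` ~` O2.
    apply/seteqP; split=> w [Kw Ow]; split => //; first exact: O12.
    by have [] := KO _ Kw.
  by apply: closedI => //; exact: open_closedC.
apply/seteqP; split; first by rewrite BC => z [].
move=> z qz; have [Cx|nCx] := pselect (C x).
  have Ux : U x by apply: BU; rewrite BC.
  have Uz := clo _ _ oU oV UV KUV Ux _ qz.
  rewrite BC; split => //; apply: contrapT => nCz.
  by apply: (UV _ Uz) => /PA; apply.
exfalso; have Vx : (~` closure P) x by move=> /PA; apply.
have VU w : (~` closure P) w -> ~ U w by move=> Vw /UV.
have qb : quasi x b by move: Bb; rewrite BC => -[].
rewrite setUC in KUV.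
by apply: (VU b); [exact: (clo _ _ oV oU VU KUV) | exact: BU].
Qed.
End CompactTotallyDisconnected.

Section TopologicalGroup.
Variable G : topologicalGroupType.
Implicit Types (N U H : set G).

Lemma continuousM (T : topologicalType) (u v : T -> G) :
  continuous u -> continuous v -> continuous (fun y => u y * v y).
Proof.
move=> cu cv x.
exact: (@continuous2_cvg _ _ _ _ _ _ u v (fun s t => s * t) (u x) (v x)
    (@mulg_continuous G (u x, v x)) (cu x) (cv x)).
Qed.

Lemma near_clopen (T : topologicalType) (f : T -> G) (K : set G) (x : T) :
  continuous f -> clopen K -> \forall y \near x, K (f y) <-> K (f x).
Proof.
move=> cf [oK cK]; have [Kx|nKx] := pselect (K (f x)).
  have : nbhs x (f @^-1` K) by apply: cf; exact: open_nbhs_nbhs.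
  by apply: filterS => y /= Ky; split.
have : nbhs x (f @^-1` (~` K)).
  by apply: cf; apply: open_nbhs_nbhs; split => //; exact: closed_openC.
by apply: filterS => y /= Ky; split.
Qed.

Definition open_normal N := is_normal N /\ open N.

Lemma normal_conj N g x : is_normal N -> N x -> N (g * x * g^-1).
Proof. by move=> [_ _ nN] Nx; exact: nN. Qed.

Lemma open_normalI N N' : open_normal N -> open_normal N' ->
  open_normal (N `&` N').
Proof.
move=> [nN oN] [nN' oN'].
have [] := open_subgroupI (conj (let: And3 s _ _ := nN in s) oN)
  (conj (let: And3 s _ _ := nN' in s) oN').
move=> sI oI; split => //; split => // g x _ [Nx N'x].
by split; exact: normal_conj.
Qed.

Lemma open_coset U x y : open U -> U (x^-1 * y) ->
  nbhs y [set z | U (x^-1 * z)].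
Proof.
move=> oU Uxy.
have c : continuous (fun z : G => x^-1 * z).
  by apply: continuousM => z; [exact: cvg_cst | exact: cvg_id].
by apply: (c y); apply: open_nbhs_nbhs.
Qed.

Lemma open_normal_coset N x : open_normal N -> nbhs x [set z | N (x^-1 * z)].
Proof.
by move=> [[[N1 _ _] _ _] oN]; apply: open_coset => //; rewrite mulVg.
Qed.

Lemma open_subgroup_clopen U : open_subgroup U -> clopen U.
Proof.
move=> [[U1 UM UV] oU]; split => // x clx.
have [|y [Uy]] := clx [set z | U (x^-1 * z)].
  by apply: open_coset => //; rewrite mulVg.
by move=> /= /UV; rewrite invgM invgK => /(UM _ _ Uy); rewrite mulVKg.
Qed.

(** The elements that can be inserted anywhere in a product without affecting
    membership in the clopen set [K] form a normal subgroup, contained in [K];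
    it is open by the tube lemma, [K] being clopen and [G * G] compact. *)
Lemma open_normal_in_clopen (K : set G) : compact [set: G] -> clopen K ->
  K 1 -> exists2 N, open_normal N & N `<=` K.
Proof.
move=> cG cK K1.
exists [set g | forall z : G * G, K (z.1 * z.2) <-> K (z.1 * g * z.2)]; last first.
  by move=> g /(_ (1, 1)) /=; rewrite !mul1g !mulg1 => -[+ _]; apply.
split; first split => //; first split => /=.
- by move=> z; rewrite mulg1.
- by move=> x y Kx Ky z; rewrite Kx (Ky (z.1 * x, z.2)) /= !mulgA.
- by move=> x Kx z; rewrite (Kx (z.1 * x^-1, z.2)) /= mulgVK.
- move=> g x _ /= Kx z; have := Kx (z.1 * g, g^-1 * z.2).
  by rewrite /= !mulgA mulgK.
rewrite openE => g Kg.
have cGG : compact [set: G * G] by rewrite -setXTT; apply: compact_setX.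
pose P (h : G) (z : G * G) := K (z.1 * z.2) <-> K (z.1 * h * z.2).
have : \forall h \near g, [set: G * G] `<=` P h.
  apply: (compact_near_coveringP _).1 cGG _ _ _ _ _ => z _.
  have c1 : continuous (fun w : (G * G) * G => w.1.1 * w.1.2).
    by apply: continuousM => w; apply: cvg_comp; [exact: cvg_fst|
       exact: cvg_fst|exact: cvg_fst|exact: cvg_snd].
  have c2 : continuous (fun w : (G * G) * G => w.1.1 * w.2 * w.1.2).
    apply: continuousM; first apply: continuousM => w.
    - by apply: cvg_comp; [exact: cvg_fst|exact: cvg_fst].
    - exact: cvg_snd.
    - by move=> w; apply: cvg_comp; [exact: cvg_fst|exact: cvg_snd].
  have n1 := near_clopen (z, g) c1 cK.
  have n2 := near_clopen (z, g) c2 cK.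
  apply: filterS (filterI n1 n2) => -[w h] /= [e1 e2].
  by rewrite /P e1 e2; exact: Kg.
by apply: filterS => h Ph z; exact: Ph.
Qed.

Section Profinite.
Hypothesis pG : profinite G.

Let cG : compact [set: G]. Proof. by have [] := pG. Qed.

Lemma open_normal_basis x O : nbhs x O ->
  exists2 N, open_normal N & forall y, N (x^-1 * y) -> O y.
Proof.
move=> xO; have [_ hG tG] := pG.
have zG := totally_disconnected_zero_dimensional cG hG tG.
have cm : continuous (fun z : G => x * z).
  by apply: continuousM => z; [exact: cvg_cst | exact: cvg_id].
have : nbhs (1 : G) [set z | O (x * z)] by apply: cm; rewrite mulg1.
move=> /(zero_dimensional_cvg hG zG cG) [K [K1 cK] KO].
have [N oN NK] := open_normal_in_clopen cG cK K1.
by exists N => // y /NK /KO /=; rewrite mulVKg.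
Qed.

Lemma open_normal_sub U : open_subgroup U -> exists2 N, open_normal N & N `<=` U.
Proof.
move=> oU; apply: open_normal_in_clopen => //; first exact: open_subgroup_clopen.
by case: oU => -[].
Qed.

Lemma open_normal_separates x : x <> 1 -> exists2 N, open_normal N & ~ N x.
Proof.
move=> x1; have [_ hG tG] := pG.
have zG := totally_disconnected_zero_dimensional cG hG tG.
have [|K [cK K1 Kx]] := zG 1 x; first by apply/eqP => /esym.
have [N oN NK] := open_normal_in_clopen cG cK K1.
by exists N => // /NK.
Qed.

End Profinite.
End TopologicalGroup.

(** * Finite quotients, and finite p-groups as discrete pro-p groups *)

Definition quotient_of p (G : groupType) (N : set G) (P : finGroupType)
    (pi : G -> P) : Prop :=
  [/\ p.-group [set: P]%SET, {morph pi : x y / x * y} &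
      forall x, pi x = 1 <-> N x].

(** The group law is transported to the ordinals indexing the cosets of [N], so
    that the quotient becomes a [finGroupType]. *)
Lemma finite_quotient p (G : topologicalGroupType) (N : set G) :
  prime p -> pro_p p G -> open_normal N ->
  exists (P : finGroupType) (pi : G -> P), quotient_of p N pi.
Proof.
move=> p_pr [_ pG] [nN oN].
have [k /card_set_bijP[f [f_to f_inj f_surj]]] := pG N nN oN.
have [[N1 NM NV] _ nNc] := nN.
pose coset (x : G) : set G := [set x * h | h in N].
have cosetE x y : coset x = coset y <-> N (x^-1 * y).
  split=> [xy|xy].
    have : coset y y by exists 1 => //; rewrite mulg1.
    by rewrite -xy => -[h Nh <-]; rewrite mulKg.
  apply/seteqP; split=> _ [h Nh <-].
    by exists (y^-1 * x * h); rewrite ?mulgA ?mulgV ?mul1g//; apply: NM => //;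
       move/NV: xy; rewrite invgM invgK.
  by exists (x^-1 * y * h); rewrite ?mulgA ?mulgV ?mul1g//; exact: NM.
have fC x : (f (coset x) < p ^ k)%N by apply: f_to; exists x.
pose q x : 'I_(p ^ k) := Ordinal (fC x).
have qE x y : q x = q y <-> N (x^-1 * y).
  rewrite -cosetE; split => [[qxy]|xy]; last by apply: val_inj; rewrite /= xy.
  by apply: f_inj; rewrite ?inE//=; [exists x|exists y].
have q_surj i : exists x, q x = i.
  have [_ [x _ <-] fi] := f_surj i (ltn_ord i).
  by exists x; apply: val_inj.
have [s sK] := choice q_surj.
pose mul i j := q (s i * s j).
pose inv i := q (s i)^-1.
have qM x y : q (x * y) = mul (q x) (q y).
  have /qE Nx : q x = q (s (q x)) by rewrite sK.
  have /qE Ny : q y = q (s (q y)) by rewrite sK.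
  apply/qE; have := NM _ _ (nNc y^-1 _ I Nx) Ny.
  by rewrite invgK invgM !mulgA mulgK.
have mulA : associative mul.
  by move=> i j l; rewrite -(sK i) -(sK j) -(sK l) -!qM mulgA.
have mul1 : left_id (q 1) mul by move=> i; rewrite -(sK i) -qM mul1g.
have mulV : left_inverse (q 1) inv mul.
  by move=> i; rewrite -{2}(sK i) /inv -qM mulVg.
pose P : finGroupType :=
  HB.pack 'I_(p ^ k) (Finite_isGroup.Build 'I_(p ^ k) mulA mul1 mulV).
exists P, q; split => //.
- by rewrite /pgroup cardsT card_ord pnatX pnat_id.
- by move=> x; rewrite -[1]/(q 1) qE mulg1; split=> [/NV|/NV//]; rewrite invgK.
Qed.

Section Discrete.
Variable P : finGroupType.

Definition discrete_group : Type := discrete_topology P.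

HB.instance Definition _ := DiscreteUniform.on discrete_group.
HB.instance Definition _ := Group.copy discrete_group P.

Let mulg_cont : continuous (fun xy : discrete_group * discrete_group => xy.1 * xy.2).
Proof.
move=> [x y]; apply/discrete_cvg.
exists ([set x], [set y]); last by move=> [u v] /= [-> ->].
by split; exact: discrete_set1.
Qed.

Let invg_cont : continuous (fun x : discrete_group => x^-1).
Proof.
move=> x; apply/discrete_cvg.
suff : nbhs x [set y : discrete_group | y^-1 = x^-1] by [].
by apply: open_nbhs_nbhs; split => //; exact: discrete_open.
Qed.

HB.instance Definition _ := isTopologicalGroup.Build discrete_group mulg_cont invg_cont.

End Discrete.

Lemma discrete_profinite (P : finGroupType) : profinite (discrete_group P).
Proof.
split; first exact/finite_compact/(@finite_finset P).
- exact: discrete_hausdorff.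
- exact/zero_dimension_totally_disconnected/discrete_zero_dimension.
Qed.

Lemma discrete_pro_p p (P : finGroupType) : prime p -> p.-group [set: P]%SET ->
  pro_p p (discrete_group P).
Proof.
move=> p_pr pP; split; first exact: discrete_profinite.
move=> N [[N1 NM NV] _ nN] _.
pose H : {set P} := [set x | `[< N x >]]%SET.
have HE x : x \in H <-> N x by rewrite inE; split => [/asboolP|?]; last exact/asboolP.
have gH : group_set H.
  apply/group_setP; split; first exact/HE.
  by move=> x y /HE Nx /HE Ny; apply/HE; exact: NM.
pose HG := Group gH.
have : p.-nat #|lcosets HG [set: P]%SET|.
  rewrite card_lcosets; apply: pnat_dvd pP; exact: dvdn_indexg.
move=> /p_natP[k Ek]; exists k; rewrite -Ek.
pose g (i : 'I_#|lcosets HG [set: P]%SET|) : set P :=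
  [set x | x \in enum_val i]%classic.
have -> : left_cosets (N : set (discrete_group P)) = range g.
  apply/seteqP; split=> [_ [x _ <-]|_ [i _ <-]].
    have xH : x *: HG \in lcosets HG [set: P]%SET by apply/lcosetsP; exists x.
    exists (enum_rank_in xH (x *: HG)) => //.
    rewrite /g enum_rankK_in//; apply/seteqP; split => y /=.
      by move=> /lcosetP[h /HE Nh ->]; exists h.
    by move=> [h Nh <-]; apply/lcosetP; exists h => //; exact/HE.
  have /lcosetsP[x _ Ex] := enum_valP i; exists x => //.
  rewrite /g Ex; apply/seteqP; split => y /=.
    by move=> [h Nh <-]; apply/lcosetP; exists h => //; exact/HE.
  by move=> /lcosetP[h /HE Nh ->]; exists h.
rewrite (card_eql (inj_card_eq _)).
  by rewrite card_eq_sym card_II.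
move=> i j _ _ gij; apply: enum_val_inj; apply/setP => x.
have : g i x = g j x by rewrite gij.
by rewrite /g /= => e; apply/idP/idP; rewrite e.
Qed.

(** * Homomorphisms from open subgroups to finite groups *)

Lemma Fp_pgroup p : prime p -> p.-group [set: 'F_p]%SET.
Proof. by move=> p_pr; rewrite /pgroup cardsT card_Fp// pnat_id. Qed.

(** A maximal subgroup of a finite p-group is normal of index p, so any proper
    subgroup is killed by a nontrivial homomorphism to ['F_p]. *)
Lemma proper_character p (P : finGroupType) (U T : {group P}) :
  prime p -> p.-group T -> U \proper T ->
  exists phi : P -> 'F_p, [/\ {in T &, {morph phi : x y / x * y}},
    {in U, forall x, phi x = 1} & exists2 x, x \in T & phi x <> 1].
Proof.
move=> p_pr pT UT.
have [UeqT|[M maxM UM]] := maximal_exists (proper_sub UT).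
  by move: UT; rewrite UeqT fintype.properxx.
have nMT := normal_norm (p_maximal_normal pT maxM).
have cQ : #|T / M| = p by rewrite card_quotient// (p_maximal_index pT).
have : T / M \isog [set: 'F_p]%SET.
  rewrite isog_cyclic_card ?cardsT ?card_Fp// ?cQ ?eqxx ?andbT.
    by apply: prime_cyclic; rewrite cardsT card_Fp.
  by apply: prime_cyclic; rewrite cQ.
move=> /isogP[f injf _]; exists (fun x => f (coset M x)); split.
- move=> x y xT yT; have nx := fintype.subsetP nMT _ xT.
  have ny := fintype.subsetP nMT _ yT.
  by rewrite morphM// morphM// mem_quotient.
- by move=> x xU; rewrite coset_id ?morph1//; exact: (fintype.subsetP UM).
have /fintype.properP[_ [x xT xM]] := maxgroupp maxM.
exists x => // fx.
have xN := fintype.subsetP nMT _ xT.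
have xQ : coset M x \in 'ker f by apply/kerP => //; exact: mem_quotient.
have /set1P /(coset_idr xN) := fintype.subsetP injf _ xQ.
by rewrite (negbTE xM).
Qed.

Section Homs.
Variables (p : nat) (F : topologicalGroupType).
Hypotheses (p_pr : prime p) (pF : pro_p p F).
Implicit Types (T U : set F).

(** Continuity is expressed by triviality on an open normal subgroup of the whole
    group, which is also required to lie in [T]; such a subgroup is stable under
    conjugation by elements outside [T]. *)
Definition hom_on T (P : finGroupType) (psi : F -> P) : Prop :=
  (forall x y, T x -> T y -> psi (x * y) = psi x * psi y) /\
  exists2 N, open_normal N & forall x, N x -> T x /\ psi x = 1.

Lemma hom_on1 T (P : finGroupType) (psi : F -> P) : hom_on T psi -> psi 1 = 1.
Proof. by move=> [_ [N [[[N1 _ _] _ _] _] /(_ 1 N1)[]]]. Qed.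

Lemma hom_onV T (P : finGroupType) (psi : F -> P) x : is_subgroup T ->
  hom_on T psi -> T x -> psi x^-1 = (psi x)^-1.
Proof.
move=> [_ TM TV] hpsi Tx; apply: (@mulgI _ (psi x)).
by rewrite -hpsi.1 ?mulgV ?(hom_on1 hpsi)//; exact: TV.
Qed.

Lemma hom_onX T (P : finGroupType) (psi : F -> P) x n : is_subgroup T ->
  hom_on T psi -> T x -> T (x ^+ n) /\ psi (x ^+ n) = psi x ^+ n.
Proof.
move=> [T1 TM TV] hpsi Tx; elim: n => [|n [Tn IH]].
  by rewrite !expg0 (hom_on1 hpsi).
by rewrite !expgS hpsi.1// IH; split => //; exact: TM.
Qed.

Lemma pro_p_profinite : profinite F. Proof. by case: pF. Qed.

Lemma open_subgroup_super N T : is_subgroup T -> open_normal N -> N `<=` T ->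
  open_subgroup T.
Proof.
move=> sT oN NT; split => //; rewrite openE => x Tx.
apply: filterS (open_normal_coset x oN) => y /= /NT; rewrite -{2}(mulVKg x y).
by have [_ TM _] := sT; exact: TM.
Qed.

Lemma hom_on_kernel T (P : finGroupType) (psi : F -> P) : open_subgroup T ->
  hom_on T psi -> open_subgroup (T `&` [set x | psi x = 1]).
Proof.
move=> [sT oT] hpsi; have [T1 TM TV] := sT; have [N oN Nker] := hpsi.2.
apply: (open_subgroup_super _ oN) => //; split.
- by split => //; exact: hom_on1 hpsi.
- move=> x y [Tx x1] [Ty y1]; split; first exact: TM.
  by rewrite /= hpsi.1// x1 y1 mulg1.
- move=> x [Tx x1]; split; first exact: TV.
  by rewrite /= (hom_onV sT hpsi)// x1 invg1.
Qed.

Definition image_in (P : finGroupType) (pi : F -> P) T : {set P} :=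
  [set y | `[< exists2 x, T x & pi x = y >]]%SET.

Lemma mem_image_in (P : finGroupType) (pi : F -> P) T x :
  T x -> pi x \in image_in pi T.
Proof. by move=> Tx; rewrite inE; apply/asboolP; exists x. Qed.

Section Quotient.
Variables (N : set F) (P : finGroupType) (pi : F -> P).
Hypotheses (oN : open_normal N) (piM : {morph pi : x y / x * y}).
Hypothesis (piK : forall x, pi x = 1 <-> N x).

Lemma quotient_hom_on : hom_on setT pi.
Proof.
by split=> [x y _ _|]; [exact: piM | exists N => // x /piK].
Qed.

Let sTT : is_subgroup [set: F]. Proof. by split. Qed.

Lemma mem_image_inE T x : is_subgroup T -> N `<=` T -> pi x \in image_in pi T -> T x.
Proof.
move=> [T1 TM TV] NT; rewrite inE => /asboolP[y Ty pixy].
rewrite -(mulVKg y x); apply: TM => //; apply: NT; apply/piK.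
by rewrite piM (hom_onV sTT quotient_hom_on)// pixy mulVg.
Qed.

Lemma image_in_group_set T : is_subgroup T -> group_set (image_in pi T).
Proof.
move=> [T1 TM TV]; apply/group_setP; split.
  by rewrite -(hom_on1 quotient_hom_on); exact: mem_image_in.
move=> x y xT yT; move: xT yT.
rewrite inE => /asboolP[u Tu <-]; rewrite inE => /asboolP[v Tv <-].
by rewrite -piM; apply: mem_image_in; exact: TM.
Qed.

Lemma preimage_group_open (C : {group P}) : open_subgroup [set x | pi x \in C].
Proof.
apply: (open_subgroup_super _ oN); last by move=> x /piK Nx; rewrite /= Nx group1.
split => /=; first by rewrite (hom_on1 quotient_hom_on) group1.
  by move=> x y Cx Cy; rewrite piM groupM.
by move=> x Cx; rewrite (hom_onV sTT quotient_hom_on)// groupV.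
Qed.

Lemma image_in_proper T U : open_subgroup T -> open_subgroup U -> N `<=` U ->
  U `<=` T -> U <> T -> image_in pi U \proper image_in pi T.
Proof.
move=> [sT _] [sU _] NU UT nUT; apply/fintype.properP; split.
  apply/fintype.subsetP => y; rewrite inE => /asboolP[x Ux <-].
  by apply: mem_image_in; exact: UT.
have [x Tx nUx] : exists2 x, T x & ~ U x.
  apply: contrapT => nex; apply: nUT; apply/seteqP; split => // x Tx.
  by apply: contrapT => nUx; apply: nex; exists x.
exists (pi x); first exact: mem_image_in.
by apply/negP => /(mem_image_inE sU NU).
Qed.

End Quotient.

Lemma open_subgroup_character T U : open_subgroup T -> open_subgroup U ->
  U `<=` T -> U <> T -> exists phi : F -> 'F_p,
  [/\ hom_on T phi, forall x, U x -> phi x = 1 & exists2 x, T x & phi x <> 1].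
Proof.
move=> oT oU UT nUT; have [N oN NU] := open_normal_sub pro_p_profinite oU.
have [P [pi [pP piM piK]]] := finite_quotient p_pr pF oN.
have UTp := image_in_proper oN piM piK oT oU NU UT nUT.
have pT : p.-group (Group (image_in_group_set oN piM piK oT.1)).
  by apply: pgroupS pP; exact: finset.subsetT.
have [|phi [phiM phiU [y yT phiy]]] := @proper_character p P
  (Group (image_in_group_set oN piM piK oU.1)) _ p_pr pT; first exact: UTp.
exists (phi \o pi); split.
- split=> [x y' Tx Ty|] /=; first by rewrite piM phiM ?mem_image_in.
  exists N => // x Nx; split; first exact/UT/NU.
  by rewrite phiU//; apply: mem_image_in; exact: NU.
- by move=> x Ux /=; rewrite phiU//; exact: mem_image_in.
- move: yT phiy; rewrite inE => /asboolP[x Tx <-] pix.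
  by exists x.
Qed.

Section Chains.
Variable Q : set F -> Prop.

(** Induction along a chain of subgroups, each of index p in the previous one, from
    the whole group to an open subgroup; the measure is the order of the image in a
    finite quotient whose kernel lies in that open subgroup. *)
Lemma open_subgroup_down :
  Q setT ->
  (forall T (phi : F -> 'F_p), open_subgroup T -> hom_on T phi ->
    (exists2 x, T x & phi x <> 1) -> Q T -> Q (T `&` [set x | phi x = 1])) ->
  forall U, open_subgroup U -> Q U.
Proof.
move=> QT step U oU; have [N oN NU] := open_normal_sub pro_p_profinite oU.
have [P [pi [pP piM piK]]] := finite_quotient p_pr pF oN.
suff H n T : (#|image_in pi T| < n)%N -> open_subgroup T -> U `<=` T -> Q T -> Q U.
  by apply: (H _ setT (ltnSn _)) => //; exact: open_subgroupT.
elim: n T => [//|n IH] T; rewrite ltnS => lT oT UT.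
have [<-//|nUT] := pselect (U = T).
have [phi [hphi phiU nphi]] := open_subgroup_character oT oU UT nUT.
move=> /(step _ _ oT hphi nphi); apply: IH;
  last by move=> x Ux; split; [exact: UT | exact: phiU].
  have oV := hom_on_kernel oT hphi.
  apply: leq_trans lT; apply: proper_card.
  apply: (image_in_proper oN piM piK) => //.
  - by move=> x Nx; split; [exact/UT/NU|exact/phiU/NU].
  - by move=> e; case: nphi => x; rewrite -{1}e => -[].
exact: hom_on_kernel.
Qed.

Lemma open_subgroup_up U :
  (forall T (phi : F -> 'F_p), open_subgroup T -> hom_on T phi ->
    (exists2 x, T x & phi x <> 1) -> Q (T `&` [set x | phi x = 1]) -> Q T) ->
  open_subgroup U -> Q U -> Q setT.
Proof.
move=> step oU QU; have [N oN NU] := open_normal_sub pro_p_profinite oU.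
have [P [pi [pP piM piK]]] := finite_quotient p_pr pF oN.
suff H n T : (#|image_in pi T| < n)%N -> open_subgroup T -> U `<=` T -> Q T.
  by apply: (H _ setT (ltnSn _)) => //; exact: open_subgroupT.
elim: n T => [//|n IH] T; rewrite ltnS => lT oT UT.
have [<-//|nUT] := pselect (U = T).
have [phi [hphi phiU nphi]] := open_subgroup_character oT oU UT nUT.
apply: (step _ _ oT hphi nphi); apply: IH;
  last by move=> x Ux; split; [exact: UT | exact: phiU].
  have oV := hom_on_kernel oT hphi.
  apply: leq_trans lT; apply: proper_card.
  apply: (image_in_proper oN piM piK) => //.
  - by move=> x Nx; split; [exact/UT/NU|exact/phiU/NU].
  - by move=> e; case: nphi => x; rewrite -{1}e => -[].
exact: hom_on_kernel.
Qed.

End Chains.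

(** In a finite quotient where [x] survives, [x] generates a nontrivial cyclic
    p-group, hence lies outside its maximal subgroup; [T] is the preimage of that
    cyclic group. *)
Lemma nontrivial_character x : x <> 1 -> exists T (phi : F -> 'F_p),
  [/\ open_subgroup T, T x, hom_on T phi & phi x <> 1].
Proof.
move=> x1; have [N oN Nx] := open_normal_separates pro_p_profinite x1.
have [P [pi [pP piM piK]]] := finite_quotient p_pr pF oN.
pose C := <[pi x]>%G.
have [|||phi [phiM _ [y yC phiy]]] := @proper_character p P 1%G C => //.
- by apply: pgroupS pP; exact: finset.subsetT.
- by rewrite proper1G cycle_eq1; apply/eqP => /piK.
exists [set y | pi y \in C], (phi \o pi).
have phi1 : phi 1 = 1.
  by apply: (@mulgI _ (phi 1)); rewrite -phiM ?group1// !mulg1.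
split => //.
- exact: (preimage_group_open oN piM piK C).
- exact: cycle_id.
- split=> [u v Cu Cv|]; first by rewrite /= piM phiM.
  by exists N => // u Nu; rewrite /= (piK u).2//; split => //; exact: group1.
- move=> /= phix; have /cycleP[n yE] := yC; case: phiy; rewrite yE.
  elim: n {yE} => [|n IH]; first by rewrite expg0.
  by rewrite expgS phiM ?phix ?IH ?mulg1//; [exact: cycle_id | exact: mem_cycle].
Qed.

End Homs.

(** * Free bases of open subgroups *)

Section Bases.
Variables (p : nat) (F : topologicalGroupType).
Hypotheses (p_pr : prime p) (pF : pro_p p F).
Implicit Types (T U : set F).

(** Only finite p-groups are tested, which makes both generation and freeness of a
    family statements about finite sets of homomorphisms. *)
Definition generates T (I : finType) (y : I -> F) : Prop :=
  forall (P : finGroupType) (f g : F -> P), p.-group [set: P]%SET ->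
    hom_on T f -> hom_on T g -> (forall i, f (y i) = g (y i)) ->
    forall x, T x -> f x = g x.

Definition free_basis T (I : finType) (y : I -> F) : Prop :=
  [/\ forall i, T (y i),
      forall P : finGroupType, p.-group [set: P]%SET ->
        forall c : I -> P, exists2 f, hom_on T f & forall i, f (y i) = c i
    & generates T y].

Lemma equalizer_open_subgroup T (P : finGroupType) (f g : F -> P) :
  open_subgroup T -> hom_on T f -> hom_on T g ->
  open_subgroup (T `&` [set x | f x = g x]).
Proof.
move=> [sT oT] hf hg; have [T1 TM TV] := sT.
have [N oN Nf] := hf.2; have [N' oN' Ng] := hg.2.
apply: (open_subgroup_super _ (open_normalI oN oN')); last first.
  by move=> x [/Nf[Tx fx] /Ng[_ gx]]; split => //=; rewrite fx gx.
split.
- by split=> //=; rewrite (hom_on1 hf) (hom_on1 hg).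
- move=> x y [Tx xE] [Ty yE]; split; first exact: TM.
  by rewrite /= hf.1// hg.1// xE yE.
- move=> x [Tx xE]; split; first exact: TV.
  by rewrite /= (hom_onV sT hf)// (hom_onV sT hg)// xE.
Qed.

(** Burnside's basis theorem: the equalizer of two homomorphisms that agree on [y]
    but not on [T] is a proper open subgroup, so some nontrivial character of [T]
    kills it, and with it [y]. *)
Lemma generates_character T (I : finType) (y : I -> F) : open_subgroup T ->
  (forall i, T (y i)) ->
  (forall phi : F -> 'F_p, hom_on T phi -> (forall i, phi (y i) = 1) ->
     forall x, T x -> phi x = 1) -> generates T y.
Proof.
move=> oT Ty H P f g pP hf hg fg x Tx.
have oU := equalizer_open_subgroup oT hf hg.
have [e|ne] := pselect (T `&` [set x | f x = g x] = T).
  by move: Tx; rewrite -e => -[].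
have [z []//|phi [hphi phiU [z Tz]]] :=
  open_subgroup_character p_pr pF oT oU _ ne.
by case; apply: H => // i; apply: phiU; split => //=; exact: fg.
Qed.

Lemma trivial_hom_on T (P : finGroupType) : open_subgroup T ->
  hom_on T (fun _ => 1 : P).
Proof.
move=> oT; split=> [x y _ _|]; first by rewrite mulg1.
have [N oN NT] := open_normal_sub (pro_p_profinite pF) oT.
by exists N => // x /NT.
Qed.

Lemma generates_open_subgroup T U (I : finType) (y : I -> F) :
  open_subgroup T -> open_subgroup U -> generates T y -> U `<=` T ->
  (forall i, U (y i)) -> U = T.
Proof.
move=> oT oU gy UT Uy; apply: contrapT => nUT.
have [phi [hphi phiU [z Tz]]] := open_subgroup_character p_pr pF oT oU UT nUT.
case; apply: (gy _ phi (fun=> 1)) => //; first exact: Fp_pgroup.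
  exact: trivial_hom_on.
by move=> i; exact: phiU.
Qed.

(** For a finite p-group [P], evaluation at [b] identifies the homomorphisms to [P]
    with the functions from [I] to [P]. Evaluation at a generating family [c] is
    injective, and an injective self-map of a finite set is onto. *)
Lemma basis_of_generates T (I : finType) (b c : I -> F) :
  free_basis T b -> (forall i, T (c i)) -> generates T c -> free_basis T c.
Proof.
move=> [Tb fb gb] Tc gc; split => // P pP d.
have /choice[psi hpsi] : forall d : {ffun I -> P}, exists f : F -> P,
    hom_on T f /\ forall i, f (b i) = d i.
  by move=> d'; have [f hf fE] := fb P pP d'; exists f.
pose e (d : {ffun I -> P}) : {ffun I -> P} := [ffun i => psi d (c i)].
have e_inj : injective e.
  move=> d1 d2 e12; apply/ffunP => i.
  have [h1 E1] := hpsi d1; have [h2 E2] := hpsi d2.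
  rewrite -E1 -E2; apply: gc (Tb i) => // j.
  by have /ffunP/(_ j) := e12; rewrite !ffunE.
have /codomP[d' d'E] : finfun d \in codom e.
  exact: (inj_card_onto e_inj).
have [h' _] := hpsi d'; exists (psi d') => // i.
by have /ffunP/(_ i) := d'E; rewrite !ffunE.
Qed.

Lemma basis_exchange T (I : finType) (b c : I -> F) : open_subgroup T ->
  free_basis T b -> (forall i, T (c i)) ->
  (forall phi : F -> 'F_p, hom_on T phi -> (forall i, phi (c i) = 1) ->
     forall i, phi (b i) = 1) -> free_basis T c.
Proof.
move=> oT bb Tc H; apply: (basis_of_generates bb) => //.
apply: generates_character => // phi hphi phic x Tx.
have [_ _ gb] := bb; apply: (gb _ phi (fun=> 1)) => //; first exact: Fp_pgroup.
  exact: trivial_hom_on.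
exact: H.
Qed.

Lemma basis_reindex T (I J : finType) (e : J -> I) (b : I -> F) : bijective e ->
  free_basis T b -> free_basis T (b \o e).
Proof.
move=> [e' eK e'K] [Tb fb gb]; split=> [i|P pP c|P f g pP hf hg fg x Tx].
- exact: Tb.
- have [f hf fE] := fb P pP (c \o e'); exists f => // i.
  by rewrite /= fE /= eK.
- apply: gb Tx => // i; rewrite -(e'K i); exact: fg.
Qed.

Lemma FpM (x y : 'F_p) : x * y = (x + y)%R. Proof. by []. Qed.
Lemma Fp1 : 1 = 0%R :> 'F_p. Proof. by []. Qed.
Lemma FpX (x : 'F_p) n : (x ^+ n)%g = (x *+ n)%R.
Proof. by elim: n => [//|n IH]; rewrite expgS IH GRing.mulrS. Qed.

Lemma character_scale T (phi : F -> 'F_p) (a : 'F_p) :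
  hom_on T phi -> hom_on T (fun x => (a * phi x)%R : 'F_p).
Proof.
move=> [phiM [N oN Nphi]]; split=> [x y Tx Ty|].
  by rewrite phiM// !FpM GRing.mulrDr.
exists N => // x /Nphi[Tx phix]; split => //.
by rewrite phix Fp1 GRing.mulr0.
Qed.

Lemma character_basis T (I : finType) (b : I -> F) (phi : F -> 'F_p) x :
  open_subgroup T -> free_basis T b -> hom_on T phi -> T x -> phi x <> 1 ->
  exists i, phi (b i) <> 1.
Proof.
move=> oT [_ _ gb] hphi Tx; apply: contra_notP => nb.
apply: (gb _ phi (fun=> 1)) => //; first exact: Fp_pgroup.
  exact: trivial_hom_on.
by move=> i; apply: contrapT => phib; apply: nb; exists i.
Qed.

(** If [psi] kills the new family, then [phi (b None) * psi] and
    [psi (b None) * phi] agree on [b]; their values at [x] show that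
    [psi (b None)] vanishes. *)
Lemma basis_replace T (J : finType) (b : option J -> F) (phi : F -> 'F_p) x :
  open_subgroup T -> free_basis T b -> hom_on T phi ->
  (forall j, phi (b (Some j)) = 1) -> T x -> phi x <> 1 ->
  free_basis T (fun i => if i is Some j then b (Some j) else x).
Proof.
move=> oT bb hphi phib Tx phix; have [Tb _ gb] := bb.
apply: (basis_exchange oT bb) => [[j|]//|psi hpsi psic].
case=> [j|]; first exact: (psic (Some j)).
have [|phib0] := pselect (phi (b None) = 1).
  move=> phib0; have [] := character_basis oT bb hphi Tx phix.
  by case=> [j|]; rewrite ?phib ?phib0.
have /= := gb _ _ _ (Fp_pgroup p_pr) (character_scale (phi (b None)) hpsi)
  (character_scale (psi (b None)) hphi) _ x Tx.
rewrite (psic None) Fp1 GRing.mulr0 => E.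
have /eqP : (0 = psi (b None) * phi x)%R.
  by apply: E => -[j|]; rewrite ?phib ?(psic (Some j)) ?Fp1 ?GRing.mulr0// GRing.mulrC.
by rewrite eq_sym GRing.mulf_eq0 => /orP[/eqP//|/eqP].
Qed.

(** Column reduction: clear [phi] on all but one element [u] of a basis, then
    replace [u] by [x]. *)
Lemma basis_adapt T (J : finType) (b : option J -> F) (phi : F -> 'F_p) x :
  open_subgroup T -> free_basis T b -> hom_on T phi -> T x -> phi x <> 1 ->
  exists y : option J -> F, [/\ free_basis T y, y None = x &
    forall j, phi (y (Some j)) = 1].
Proof.
move=> oT bb hphi Tx phix.
have [i phib] := character_basis oT bb hphi Tx phix.
pose b1 := b \o tperm None i.
have bb1 : free_basis T b1.
  by apply: basis_reindex bb; exists (tperm None i) => z; rewrite tpermK.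
have phib1 : phi (b1 None) <> 1 by rewrite /b1 /= tpermL.
pose u := b1 None.
pose n j := val (- (phi (b1 (Some j)) / phi u))%R.
pose b2 i := if i is Some j then b1 (Some j) * u ^+ n j else u.
have [Tb1 _ _] := bb1.
have uX k := hom_onX k oT.1 hphi (Tb1 None).
have Tb2 i' : T (b2 i').
  case: i' => [j|] /=; last exact: Tb1.
  by have [_ TM _] := oT.1; apply: TM; [exact: Tb1|exact: (uX _).1].
have bb2 : free_basis T b2.
  apply: (basis_exchange oT bb1) => // psi hpsi psib [j|]; last exact: (psib None).
  have := psib (Some j); rewrite /= hpsi.1 ?(hom_onX _ oT.1 hpsi (Tb1 None)).2//.
  - by rewrite (psib None) expg1n mulg1.
  - exact: (uX _).1.
exists (fun i => if i is Some j then b2 (Some j) else x).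
have phib2 j : phi (b2 (Some j)) = 1.
  rewrite /= hphi.1//; last exact: (uX _).1.
  rewrite (uX _).2 FpX FpM Fp1 -GRing.mulr_natl natr_Zp.
  rewrite GRing.mulNr GRing.mulfVK ?GRing.subrr//.
  by apply/eqP.
by split => //; exact: basis_replace phix.
Qed.

Lemma basis_dual T (J : finType) (b : option J -> F) : free_basis T b ->
  exists2 phi : F -> 'F_p, hom_on T phi &
    phi (b None) = 1%R /\ forall j, phi (b (Some j)) = 1.
Proof.
move=> [_ fb _].
have [phi hphi phiE] := fb _ (Fp_pgroup p_pr)
  (fun i => if i is Some _ then 1 else 1%R).
by exists phi => //; split=> [|j]; rewrite phiE.
Qed.
End Bases.

(** * Schreier bases of subgroups of index p *)

Section Wreath.
Variables (P A : finGroupType).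

(** [A] acts on the functions from [A] to [P] by translation of the argument. *)
Definition wreath : Type := ({ffun A -> P} * A)%type.
HB.instance Definition _ := Finite.on wreath.

Implicit Types x y z : wreath.

Let mul x y : wreath := ([ffun a => x.1 a * y.1 (a * x.2)], x.2 * y.2).
Let one : wreath := ([ffun => 1], 1).
Let inv x : wreath := ([ffun a => (x.1 (a * x.2^-1))^-1], x.2^-1).

Let wreath_mulA : associative mul.
Proof.
move=> x y z; congr pair; last by rewrite /= mulgA.
by apply/ffunP => a; rewrite !ffunE /= !mulgA.
Qed.

Let wreath_mul1 : left_id one mul.
Proof.
move=> [f s]; congr pair; last by rewrite /= mul1g.
by apply/ffunP => a; rewrite !ffunE /= mul1g mulg1.
Qed.

Let wreath_mulV : left_inverse one inv mul.
Proof.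
move=> [f s]; congr pair; last by rewrite /= mulVg.
by apply/ffunP => a; rewrite !ffunE /= mulVg.
Qed.

HB.instance Definition _ :=
  Finite_isGroup.Build wreath wreath_mulA wreath_mul1 wreath_mulV.

Lemma wreathM1 x y a : (x * y).1 a = x.1 a * y.1 (a * x.2).
Proof. by rewrite /= ffunE. Qed.

Lemma wreathM2 x y : (x * y).2 = x.2 * y.2. Proof. by []. Qed.

Lemma wreathX2 x n : (x ^+ n).2 = x.2 ^+ n.
Proof. by elim: n => [//|n IH]; rewrite !expgS wreathM2 IH. Qed.

Lemma wreath_pgroup p : p.-group [set: P]%SET -> p.-group [set: A]%SET ->
  p.-group [set: wreath]%SET.
Proof.
rewrite /pgroup !cardsT => pP pA.
by rewrite card_prod card_ffun pnatM pnatX pP pA.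
Qed.

End Wreath.

(** The kernel [V] of a character [phi] of [T] has index p, with transversal the
    powers of the basis element [t] on which [phi] is one. Homomorphisms from [V]
    to [P] correspond to homomorphisms from [T] to the wreath product of [P] by
    ['F_p] which lift [phi]: restrict and take the component at zero in one
    direction, induce in the other. Hence freeness of [T] passes to [V]. *)
Section Schreier.
Variables (p : nat) (F : topologicalGroupType).
Hypotheses (p_pr : prime p) (pF : pro_p p F).
Variables (T : set F) (J : finType) (b : option J -> F) (phi : F -> 'F_p).
Hypotheses (oT : open_subgroup T) (bb : free_basis p T b) (hphi : hom_on T phi).
Hypotheses (phit : phi (b None) = 1%R) (phib : forall j, phi (b (Some j)) = 1).

Let t := b None.
Let V := T `&` [set x | phi x = 1].
Let tau (a : 'F_p) : F := t ^+ val a.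

(** The index [None] stands for the p-th power of [t], and [Some (a, j)] for the
    conjugate of [b (Some j)] by the [a]-th power of [t]. *)
Definition schreier (i : option ('F_p * J)) : F :=
  if i is Some (a, j) then tau a * b (Some j) * (tau a)^-1 else t ^+ p.

Let oV : open_subgroup V. Proof. exact: hom_on_kernel. Qed.
Let Tb i : T (b i). Proof. by case: bb. Qed.
Let TM x y : T x -> T y -> T (x * y). Proof. by case: oT => -[_ H _] _; exact: H. Qed.
Let TV x : T x -> T x^-1. Proof. by case: oT => -[_ _ H] _; exact: H. Qed.
Let phiM x y : T x -> T y -> phi (x * y) = (phi x + phi y)%R.
Proof. by move=> Tx Ty; rewrite hphi.1. Qed.
Let phiV x : T x -> phi x^-1 = (- phi x)%R.
Proof. by move=> Tx; rewrite (hom_onV oT.1 hphi). Qed.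
Let TX n : T (t ^+ n). Proof. by have [] := hom_onX n oT.1 hphi (Tb None). Qed.
Let phiX n : phi (t ^+ n) = (n%:R)%R.
Proof. by have [_ ->] := hom_onX n oT.1 hphi (Tb None); rewrite phit FpX. Qed.
Let Ttau a : T (tau a). Proof. exact: TX. Qed.
Let phitau a : phi (tau a) = a. Proof. by rewrite phiX natr_Zp. Qed.
Let Fp_char : (p%:R = 0 :> 'F_p)%R.
Proof. by apply: val_inj; rewrite /= val_Fp_nat ?modnn//= prime_gt1. Qed.
Let val_lt (a : 'F_p) : (val a < p)%N.
Proof. by rewrite -[X in (_ < X)%N](Fp_cast p_pr) ltn_ord. Qed.
Let val_succ (a : 'F_p) : val (a + 1)%R = if (val a).+1 == p then 0%N else (val a).+1.
Proof.
rewrite -{1}(natr_Zp a) GRing.natr1 /= val_Fp_nat//.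
case: eqP => [->|ne]; first by rewrite modnn.
by rewrite modn_small// ltn_neqAle val_lt andbT; apply/eqP.
Qed.

Lemma schreier_mem i : V (schreier i).
Proof.
case: i => [[a j]|] /=; split => //=; last by rewrite phiX.
  by apply: TM; [exact: TM | exact: TV].
have Ttb : T (tau a * b (Some j)) by exact: TM.
have TVt : T (tau a)^-1 by exact: TV.
by rewrite !phiM// phiV// phib phitau Fp1 GRing.addr0 GRing.subrr.
Qed.

Lemma schreier_extend (P : finGroupType) (c : option ('F_p * J) -> P) :
  p.-group [set: P]%SET -> exists2 f, hom_on V f & forall i, f (schreier i) = c i.
Proof.
move=> pP; have [_ fb gb] := bb.
have pA := Fp_pgroup p_pr.
(* At 1, the first component of the n-th power of [d None] is the product of the
   values of [d None] at 0, ..., n - 1; only the value at p - 1 is nontrivial. *)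
pose d i : wreath P 'F_p := if i is Some j then ([ffun a => c (Some (a, j))], 1)
  else ([ffun a : 'F_p => if (val a).+1 == p then c None else 1], 1%R).
have [theta htheta thetaE] := fb _ (wreath_pgroup pP pA) d.
have theta2 x : T x -> (theta x).2 = phi x.
  apply: (gb _ (fun x => (theta x).2) phi) => //.
    split=> [u v Tu Tv|]; first by rewrite htheta.1.
    have [N oN Nt] := htheta.2; exists N => // u /Nt[Tu ->] //.
  by move=> [j|]; rewrite thetaE ?phib ?phit.
have thetaX n : theta (t ^+ n) = (d None) ^+ n.
  by have [_ ->] := hom_onX n oT.1 htheta (Tb None); rewrite thetaE.
have dX n : (n < p)%N -> ((d None) ^+ n).1 1 = 1.
  elim: n => [|n IH] np; first by rewrite expg0 ffunE.
  rewrite expgSr wreathM1 IH ?(ltnW np)// mul1g mul1g wreathX2 ffunE FpX.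
  rewrite /= val_Fp_nat// modn_small ?(ltnW np)//.
  by rewrite (ltn_eqF np).
exists (fun x => (theta x).1 1).
  split=> [x y [Tx x1] [Ty y1]|].
    by rewrite htheta.1// wreathM1 mul1g theta2// x1.
  have [N oN Nt] := htheta.2.
  have [N' oN' NV] := open_normal_sub (pro_p_profinite pF) oV.
  exists (N `&` N'); first exact: open_normalI.
  by move=> x [/Nt[Tx ->] /NV] Vx; split => //; rewrite ffunE.
case=> [[a j]|] /=; last first.
  rewrite thetaX -[X in _ ^+ X](prednK (prime_gt0 p_pr)) expgSr wreathM1.
  rewrite dX ?prednK ?prime_gt0// mul1g mul1g wreathX2 ffunE FpX.
  by rewrite /= val_Fp_nat// modn_small ?prednK ?prime_gt0// eqxx.
have [Ts s1] := schreier_mem (Some (a, j)).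
have E : theta (schreier (Some (a, j))) * theta (tau a) =
    theta (tau a) * theta (b (Some j)).
  by rewrite -!htheta.1// /schreier mulgVK.
have tau1 : (theta (tau a)).1 1 = 1 by rewrite thetaX dX.
move: (congr1 (fun w : wreath P 'F_p => w.1 1) E).
rewrite !wreathM1 theta2// s1 mulg1 tau1 mulg1 mul1g mul1g => ->.
by rewrite theta2// phitau thetaE ffunE.
Qed.

(** The homomorphism induced from [f] along the transversal [tau]. *)
Let induced (P : finGroupType) (f : F -> P) (x : F) : wreath P 'F_p :=
  ([ffun a => f (tau a * x * (tau (a + phi x)%R)^-1)], phi x).

Let induced_mem a x : T x -> V (tau a * x * (tau (a + phi x)%R)^-1).
Proof.
move=> Tx; have Ttax : T (tau a * x) by exact: TM.
have TVt : T (tau (a + phi x)%R)^-1 by exact: TV.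
split; first by apply: TM.
by rewrite /= !phiM// phiV// !phitau Fp1 GRing.subrr.
Qed.

Let induced_hom (P : finGroupType) (f : F -> P) : hom_on V f -> hom_on T (induced f).
Proof.
move=> hf; split=> [x y Tx Ty|].
  congr pair; last exact: hphi.1.
  apply/ffunP => a; rewrite !ffunE /= FpM phiM// GRing.addrA.
  rewrite -hf.1; [|exact: induced_mem|exact: induced_mem].
  by rewrite !mulgA mulgVK.
have [N oN Nf] := hf.2; exists N => // x Nx; have [[Tx x1] _] := Nf x Nx.
split => //; congr pair => //; apply/ffunP => a; rewrite !ffunE x1.
rewrite Fp1 GRing.addr0; apply: (proj2 (Nf _ _)).
exact: normal_conj oN.1 Nx.
Qed.

Lemma schreier_generates : generates p V schreier.
Proof.
move=> P f g pP hf hg fg; have [_ _ gb] := bb.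
have E : forall x, T x -> induced f x = induced g x.
  apply: gb; [exact: wreath_pgroup (Fp_pgroup p_pr)|exact: induced_hom|
    exact: induced_hom|].
  case=> [j|]; congr pair; apply/ffunP => a; rewrite !ffunE.
    by rewrite phib Fp1 GRing.addr0; exact: (fg (Some (a, j))).
  rewrite phit /tau val_succ -expgSr; case: eqP => [->|_].
    by rewrite expg0 invg1 mulg1; exact: (fg None).
  by rewrite mulgV (hom_on1 hf) (hom_on1 hg).
move=> x [Tx x1]; have := congr1 (fun w : wreath P 'F_p => w.1 0%R) (E x Tx).
by rewrite /= !ffunE x1 Fp1 GRing.addr0 /tau expg0 mul1g invg1 mulg1.
Qed.

Lemma schreier_basis : free_basis p V schreier.
Proof.
split; [exact: schreier_mem | | exact: schreier_generates].
by move=> P pP c; exact: schreier_extend.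
Qed.

End Schreier.

Arguments schreier p {F J} b i.

(** * Open subgroups of a free pro-p group are free *)

Section OpenSubgroups.
Variables (p : nat) (F : topologicalGroupType).
Hypotheses (p_pr : prime p) (pF : pro_p p F).
Implicit Types (T U : set F).

(** The kernel of [phi] put in the position required for taking a Schreier basis,
    with a prescribed transversal generator [x]. *)
Lemma adapted_schreier T (J : finType) (b : option J -> F) (phi : F -> 'F_p) x :
  open_subgroup T -> free_basis p T b -> hom_on T phi -> T x -> phi x <> 1 ->
  exists (y : option J -> F) (psi : F -> 'F_p),
   [/\ free_basis p T y, hom_on T psi, y None = x, psi x = 1%R &
   (forall j, psi (y (Some j)) = 1) /\
   T `&` [set z | phi z = 1] = T `&` [set z | psi z = 1]].
Proof.
move=> oT bb hphi Tx phix.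
have [y [by_ yx phiy]] := basis_adapt p_pr pF oT bb hphi Tx phix.
have phix0 : phi x != 0%R by apply/eqP.
exists y, (fun z => (phi x)^-1 * phi z)%R; split => //.
- exact: character_scale.
- by rewrite GRing.mulVf.
split=> [j|]; first by rewrite phiy Fp1 GRing.mulr0.
apply/seteqP; split=> z [Tz] /= zE; split => //=.
  by rewrite zE Fp1 GRing.mulr0.
by move/eqP: zE; rewrite Fp1 GRing.mulf_eq0 GRing.invr_eq0 (negbTE phix0) => /eqP.
Qed.

(** Indexing by [option J] singles out an element of the basis for exchanges and
    Schreier generators, and an inhabitant of [J] says that the rank is at least
    two. *)
Definition has_basis T :=
  exists (J : finType) (b : option J -> F), free_basis p T b /\ inhabited J.

Lemma open_has_basis U : has_basis setT -> open_subgroup U -> has_basis U.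
Proof.
move=> bF; apply: (open_subgroup_down p_pr pF) => //.
move=> T phi oT hphi [x Tx phix] [J [b [bb [j0]]]].
have [y [psi [by_ hpsi yx psix [psiy ->]]]] := adapted_schreier oT bb hphi Tx phix.
exists ('F_p * J)%type, (schreier p y); split; last exact: inhabits (0%R, j0).
by apply: schreier_basis => //; rewrite yx.
Qed.

Lemma free_pro_p_free_basis n (x : 'I_n -> F) : free_pro_p_basis p x ->
  free_basis p setT x.
Proof.
move=> [_ univ].
have homE (P : finGroupType) (f : F -> P) :
    hom_on setT f <-> continuous_morphism (f : F -> discrete_group P).
  split=> [[fM [N oN Nf]]|[fM fc]].
    split; first by move=> u v; exact: fM.
    move=> u; apply/discrete_cvg.
    apply: filterS (open_normal_coset u oN) => z /= /Nf[_ uz].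
    by rewrite -(mulVKg u z) fM// uz mulg1.
  split=> [u v _ _|]; first exact: fM.
  have f1 : f 1 = 1 by apply: (@mulgI _ (f 1)); rewrite -fM !mulg1.
  have : nbhs (1 : F) (f @^-1` [set 1]).
    apply: (fc 1).
    by apply: open_nbhs_nbhs; split => //; exact: (@discrete_open (discrete_group P)).
  move=> /(open_normal_basis (pro_p_profinite pF))[N oN Nf].
  by exists N => // z Nz; split => //; apply: Nf; rewrite invg1 mul1g.
split=> // [P pP c|P f g pP /homE hf /homE hg fg z _].
  have [f [[/homE hf fE] _]] := univ (discrete_group P) c (discrete_pro_p p_pr pP).
  by exists f.
have [h [_ hU]] := univ (discrete_group P) (fun i => f (x i)) (discrete_pro_p p_pr pP).
have hfE : h = f := hU f (conj hf (fun=> erefl)).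
have hgE : h = g := hU g (conj hg (fun i => esym (fg i))).
by rewrite -hfE hgE.
Qed.

(** In a finite quotient the preimage of the cyclic group generated by the image of
    the basis is an open subgroup containing the basis, hence everything. *)
Lemma procyclic_abelian n (x : 'I_n -> F) : free_basis p setT x -> (n <= 1)%N ->
  forall u v : F, u * v = v * u.
Proof.
move=> bx n1 u v; apply: contrapT => uv.
have : [~ u, v] <> 1 by move=> /eqP/commgP.
move=> /(open_normal_separates (pro_p_profinite pF))[N oN].
have [P [pi [pP piM piK]]] := finite_quotient p_pr pF oN.
have hpi := quotient_hom_on oN piM piK.
apply; apply/piK.
have [c cx] : exists c, forall i, pi (x i) \in <[c]>.
  case: n n1 x bx => [|[|//]] _ x bx; first by exists 1; case.
  by exists (pi (x ord0)) => i; rewrite ord1; exact: cycle_id.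
have sT : is_subgroup [set: F] by [].
pose C := <[c]>%G.
have oC := preimage_group_open oN piM piK C.
have CT : [set z | pi z \in C] = setT.
  have [_ _ gx] := bx.
  exact: (generates_open_subgroup p_pr pF (open_subgroupT F) oC gx).
have piV w : pi w^-1 = (pi w)^-1 by exact: (hom_onV sT hpi).
have Cz z : pi z \in C by have : [set: F] z by []; rewrite -CT.
rewrite !piM !piV; apply/eqP/commgP.
exact: (centsP (cycle_abelian c)).
Qed.

Lemma free_has_basis n (x : 'I_n -> F) : free_pro_p_basis p x ->
  (exists u v : F, u * v <> v * u) -> has_basis setT.
Proof.
move=> /free_pro_p_free_basis bx [u [v uv]].
case: n x bx => [|[|n]] x bx; [by have := procyclic_abelian bx isT u v|
  by have := procyclic_abelian bx isT u v|].
exists 'I_n.+1, (x \o (fun i => if i is Some j then lift ord0 j else ord0)).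
split; last exact: inhabits ord0.
apply: basis_reindex bx; exists (unlift ord0) => [[j|]|i].
- by rewrite liftK.
- by rewrite unlift_none.
- by case: unliftP.
Qed.

End OpenSubgroups.

(** * Automorphisms exchanging two bases *)

Section Automorphisms.
Variables (p : nat) (F : topologicalGroupType).
Hypotheses (p_pr : prime p) (pF : pro_p p F).
Variables (W : set F) (I : finType).
Hypothesis oW : open_subgroup W.

Let WM x y : W x -> W y -> W (x * y). Proof. by case: oW => -[_ H _] _; exact: H. Qed.
Let WV x : W x -> W x^-1. Proof. by case: oW => -[_ _ H] _; exact: H. Qed.
Let proF := pro_p_profinite pF.

Lemma quotient_of_eq N (P : finGroupType) (pi : F -> P) x y : open_normal N ->
  quotient_of p N pi -> (pi x = pi y <-> N (x^-1 * y)).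
Proof.
move=> oN [_ piM piK]; rewrite -piK piM.
have sT : is_subgroup [set: F] by [].
rewrite (hom_onV sT (quotient_hom_on oN piM piK))//.
by split=> [->|]; [rewrite mulVg | move=> /mulg1_eq; rewrite invgK].
Qed.

Lemma eq_mod_open_normal (x y : F) :
  (forall N, open_normal N -> N (x^-1 * y)) -> x = y.
Proof.
move=> H; apply/esym/(@mulgI _ x^-1); rewrite mulVg; apply: contrapT.
by move=> /(open_normal_separates proF)[N /H].
Qed.

Definition endomorphism_on (theta : F -> F) : Prop :=
  [/\ forall u, W u -> W (theta u),
      forall u v, W u -> W v -> theta (u * v) = theta u * theta v &
      forall N, open_normal N -> exists2 N', open_normal N' &
        forall u, N' u -> W u /\ N (theta u)].

Lemma endomorphism_on_comp theta eta : endomorphism_on theta ->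
  endomorphism_on eta -> endomorphism_on (theta \o eta).
Proof.
move=> [tW tM tC] [eW eM eC]; split=> [u Wu|u v Wu Wv|N oN] /=.
- exact/tW/eW.
- by rewrite eM// tM//; exact: eW.
- have [N' oN' H] := tC N oN; have [N2 oN2 H'] := eC N' oN'.
  by exists N2 => // u /H'[Wu /H[]].
Qed.

Lemma endomorphism_on_continuous theta : endomorphism_on theta ->
  {within W, continuous theta}.
Proof.
move=> [_ thetaM thetaC]; rewrite continuous_open_subspace; last by case: oW.
move=> x /set_mem Wx O /(open_normal_basis proF)[N oN NO].
have [N' oN' H] := thetaC N oN.
apply: filterS (open_normal_coset x oN') => y /= /H[Wxy Ny]; apply: NO.
by rewrite -(mulVKg x y) thetaM// mulKg.
Qed.

(** A family [c] in [W] is the image of the basis [b] under an endomorphism of [W]: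
    modulo each open normal subgroup the required homomorphism exists, and
    compactness glues its values. *)
Section Extension.
Variables b c : I -> F.
Hypotheses (bb : free_basis p W b) (Wc : forall i, W (c i)).

(** [psi] is what the endomorphism to be built must become modulo [N]. *)
Let approx N (P : finGroupType) (pi psi : F -> P) : Prop :=
  [/\ quotient_of p N pi, hom_on W psi & forall i, psi (b i) = pi (c i)].

Let approx_ex N : open_normal N -> exists (P : finGroupType) (pi psi : F -> P),
  approx N pi psi.
Proof.
move=> oN; have [P [pi [pP piM piK]]] := finite_quotient p_pr pF oN.
have [_ fb _] := bb; have [psi hpsi psiE] := fb P pP (pi \o c).
by exists P, pi, psi; split.
Qed.

(** The elements of [W] for which both congruences have a common solution form an
   open subgroup of [W] containing the basis. *)
Let approx_joint N N' (P P' : finGroupType) (pi psi : F -> P) (pi' psi' : F -> P') u :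
  open_normal N -> open_normal N' ->
  approx N pi psi -> approx N' pi' psi' -> W u ->
  exists w, [/\ W w, pi w = psi u & pi' w = psi' u].
Proof.
move=> oN oN' [[pP piM piK] hpsi psib] [[pP' piM' piK'] hpsi' psib'] Wu.
have hpi := quotient_hom_on oN piM piK.
have hpi' := quotient_hom_on oN' piM' piK'.
have sT : is_subgroup [set: F] by [].
pose U := [set v | W v /\ exists w, [/\ W w, pi w = psi v & pi' w = psi' v]].
have [N1 oN1 N1psi] := hpsi.2; have [N2 oN2 N2psi] := hpsi'.2.
have W1 : W 1 by case: oW => -[].
suff : U = W by move=> UW; have [] : U u by rewrite UW.
apply: (generates_open_subgroup p_pr pF oW (y := b)).
- apply: (open_subgroup_super _ (open_normalI oN1 oN2)); last first.
    move=> v [/N1psi[Wv psiv] /N2psi[_ psiv']]; split => //.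
    by exists 1; rewrite (hom_on1 hpi) (hom_on1 hpi').
  split.
  + split => //; exists 1.
    by rewrite (hom_on1 hpi) (hom_on1 hpi') (hom_on1 hpsi) (hom_on1 hpsi').
  + move=> v v' [Wv [w [Ww e1 e2]]] [Wv' [w' [Ww' e1' e2']]].
    split; first exact: WM.
    exists (w * w'); split; first exact: WM.
      by rewrite piM hpsi.1// e1 e1'.
    by rewrite piM' hpsi'.1// e2 e2'.
  + move=> v [Wv [w [Ww e1 e2]]]; split; first exact: WV.
    exists w^-1; split; first exact: WV.
      by rewrite (hom_onV sT hpi)// (hom_onV oW.1 hpsi)// e1.
    by rewrite (hom_onV sT hpi')// (hom_onV oW.1 hpsi')// e2.
- by case: bb.
- by move=> v [].
- by move=> i; split; [case: bb | exists (c i)].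
Qed.

Let approx_mono N N' (P P' : finGroupType) (pi psi : F -> P) (pi' psi' : F -> P') u w :
  open_normal N -> open_normal N' -> N `<=` N' ->
  approx N pi psi -> approx N' pi' psi' -> W u -> pi w = psi u -> pi' w = psi' u.
Proof.
move=> oN oN' NN' a a' Wu e.
have [w' [Ww' e1 <-]] := approx_joint oN oN' a a' Wu.
have [q _ _] := a; have [q' _ _] := a'.
apply/(quotient_of_eq _ _ oN' q'); apply: NN'.
by apply/(quotient_of_eq _ _ oN q); rewrite e e1.
Qed.

(** [w] is a possible value at [u]: all congruences hold. *)
Let target u w : Prop := W w /\ forall N (P : finGroupType) (pi psi : F -> P),
  open_normal N -> approx N pi psi -> pi w = psi u.

Let target_ex u : W u -> exists w, target u w.
Proof.
move=> Wu.
pose A (N : set F) := [set w | W w /\ forall (P : finGroupType) (pi psi : F -> P),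
  approx N pi psi -> pi w = psi u].
pose FF := filter_from (@open_normal F) A.
have FFF : ProperFilter FF.
  apply: filter_from_proper; last first.
    move=> N oN; have [P [pi [psi a]]] := approx_ex oN.
    have [w [Ww e _]] := approx_joint oN oN a a Wu.
    exists w; split => // P' pi' psi' a'.
    exact: (approx_mono oN oN _ a a').
  apply: filter_from_filter.
    have [N oN _] := open_normal_sub proF oW; by exists N.
  move=> N N' oN oN'; have oI := open_normalI oN oN'; exists (N `&` N') => //.
  move=> w [Ww H]; have [P [pi [psi a]]] := approx_ex oI.
  have e := H _ _ _ a.
  split; split => // P' pi' psi' a'.
    by apply: (approx_mono oI oN _ a a') => // z [].
  by apply: (approx_mono oI oN' _ a a') => // z [].
have [cF _ _] := proF.
have FT : FF setT by apply: filterT.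
have [w [_ clw]] := cF _ FFF FT.
have near_w N : open_normal N -> exists w', A N w' /\ N (w^-1 * w').
  move=> oN; apply: clw; first by exists N.
  exact: open_normal_coset.
exists w; split=> [|N P pi psi oN a].
  have [N oN NW] := open_normal_sub proF oW.
  have [w' [[Ww' _] /NW Nw]] := near_w N oN.
  have -> : w = w' * (w^-1 * w')^-1 by rewrite invgM invgK mulVKg.
  by apply: WM => //; exact: WV.
have [w' [[_ H] Nw]] := near_w N oN.
have [q _ _] := a; rewrite -(H _ _ _ a).
by apply/(quotient_of_eq _ _ oN q).
Qed.

Lemma endomorphism_ex : exists2 theta : F -> F, endomorphism_on theta &
  forall i, theta (b i) = c i.
Proof.
have /choice[theta thetaP] : forall u, exists w, W u -> target u w.
  by move=> u; have [/target_ex[w ?]|nWu] := pselect (W u); [exists w | exists 1].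
have Wb i : W (b i) by case: bb.
exists theta; first split.
- by move=> u /thetaP[].
- move=> u v Wu Wv; apply: eq_mod_open_normal => N oN.
  have [P [pi [psi a]]] := approx_ex oN; have [q hpsi _] := a.
  have [_ piM _] := q.
  apply/(quotient_of_eq _ _ oN q).
  rewrite piM (proj2 (thetaP _ Wu) N P pi psi)// (proj2 (thetaP _ Wv) N P pi psi)//.
  by rewrite (proj2 (thetaP _ (WM Wu Wv)) N P pi psi)// hpsi.1.
- move=> N oN; have [P [pi [psi a]]] := approx_ex oN; have [[_ _ piK] hpsi _] := a.
  have [N' oN' N'psi] := hpsi.2; exists N' => // u /N'psi[Wu psiu].
  by split => //; apply/piK; rewrite (proj2 (thetaP _ Wu) N P pi psi).
- move=> i; apply: eq_mod_open_normal => N oN.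
  have [P [pi [psi a]]] := approx_ex oN; have [q hpsi e] := a.
  apply/(quotient_of_eq _ _ oN q).
  by rewrite (proj2 (thetaP _ (Wb i)) N P pi psi).
Qed.

End Extension.

(** Reductions of [theta] and of the identity agree on the basis. *)
Lemma endomorphism_id (b : I -> F) (theta : F -> F) : free_basis p W b ->
  endomorphism_on theta -> (forall i, theta (b i) = b i) ->
  forall u, W u -> theta u = u.
Proof.
move=> [Wb _ gb] [thetaW thetaM thetaC] thetab u Wu.
apply: eq_mod_open_normal => N oN.
have [P [pi [pP piM piK]]] := finite_quotient p_pr pF oN.
apply/(quotient_of_eq _ _ oN); first by split; first exact: pP.
apply: (gb P (pi \o theta) pi) => //.
- split=> [x y Wx Wy|] /=; first by rewrite thetaM.
  have [N' oN' H] := thetaC N oN; exists N' => // x /H[Wx Nx].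
  by split => //=; apply/piK.
- split=> [x y Wx Wy|]; first exact: piM.
  have [N' oN' H] := thetaC N oN; exists (N `&` N'); first exact: open_normalI.
  by move=> x [/piK -> /H[]].
- by move=> i /=; rewrite thetab.
Qed.

Lemma basis_automorphism (b c : I -> F) : free_basis p W b -> free_basis p W c ->
  exists f : local_iso F, dom f = W /\ forall i, fwd f (b i) = c i.
Proof.
move=> bb bc; have Wb i : W (b i) by case: bb.
have Wc i : W (c i) by case: bc.
have [f ef fb] := endomorphism_ex bb Wc; have [g eg gc] := endomorphism_ex bc Wb.
have gf : forall u, W u -> g (f u) = u.
  apply: (endomorphism_id bb (endomorphism_on_comp eg ef)) => i.
  by rewrite /= fb gc.
have fg : forall u, W u -> f (g u) = u.
  apply: (endomorphism_id bc (endomorphism_on_comp ef eg)) => i.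
  by rewrite /= gc fb.
have [[fW fM _] [gW _ _]] := (ef, eg).
by exists (@LocalIso F W W f g oW oW fW gW gf fg fM
  (endomorphism_on_continuous ef) (endomorphism_on_continuous eg)).
Qed.

End Automorphisms.

(** * Subgroups of the commensurator absorbing F *)

Section Commensurator.
Variable F : topologicalGroupType.
Implicit Types (K : set (Comm F)) (a k : Comm F) (x y g : F).

Lemma inner1 : inner 1 = 1 :> Comm F.
Proof. by apply: (@mulgI _ (inner (1 : F))); rewrite -innerM !mulg1. Qed.

Lemma innerV g : inner g^-1 = (inner g)^-1.
Proof. by apply: (@mulgI _ (inner g)); rewrite -innerM !mulgV inner1. Qed.

Lemma inner_fwd (f : local_iso F) x : dom f x ->
  comm_class f * inner x * (comm_class f)^-1 = inner (fwd f x).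
Proof.
move=> fx.
have -> : (comm_class f)^-1 = comm_class (local_iso_inv f) by exact: comm_invE.
rewrite [X in X * _ = _]comm_mulE [LHS]comm_mulE; apply/comm_classP.
have [d1 dM dV] := (dom_open_subgroup f).1.
have xf y : cod f y -> dom f (x * bwd f y * x^-1).
  by move=> /bwd_dom fy; apply: (dM) => //; [exact: dM | exact: dV].
exists (cod f); split; first exact: cod_open_subgroup.
  by move=> y fy; split => //; split => //; split => //; exact: xf.
move=> y fy; have by_ := bwd_dom fy; rewrite /= /conj_by fwdM ?fwdM ?fwdV ?bwdK//.
  exact: dM.
exact: dV.
Qed.

(** [K] is normalised by the normal closure of [F]. Normal subgroups of
    [Comm F] have this property, and so have those of the monolith once it is known
    to contain [F]. *)
Definition absorbing K : Prop := is_subgroup K /\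
  forall a g k, K k -> K (a * inner g * a^-1 * k * (a * inner g * a^-1)^-1).

Lemma absorbing_inner K g k : absorbing K -> K k -> K (inner g * k * (inner g)^-1).
Proof. by move=> [_ /(_ 1 g k) H] /H; rewrite !mul1g !invg1 !mulg1. Qed.

Lemma absorbing_conj K a : absorbing K -> absorbing [set k | K (a * k * a^-1)].
Proof.
move=> [[K1 KM KV] KN]; split; first split => /=.
- by rewrite mulg1 mulgV.
- move=> k k' Kk Kk'; have := KM _ _ Kk Kk'.
  by rewrite !mulgA mulgVK.
- by move=> k /KV; rewrite !invgM invgK !mulgA.
move=> c g k /= /(KN (a * c) g); rewrite !invgM !invgK !mulgA.
by rewrite !mulgVK.
Qed.

(** Conjugacy of [x] and [y] under the normal closure of [F] implies that they are
    linked. Unlike conjugacy under a given group, being linked is manifestly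
    preserved by every local isomorphism, because conjugating an absorbing subgroup
    gives an absorbing subgroup. *)
Definition linked x y : Prop := forall K, absorbing K -> (K (inner x) <-> K (inner y)).

Lemma linked_sym x y : linked x y -> linked y x.
Proof. by move=> xy K KN; rewrite (xy K KN). Qed.

Lemma linked_trans x y z : linked x y -> linked y z -> linked x z.
Proof. by move=> xy yz K KN; rewrite (xy K KN); exact: yz. Qed.

Lemma linked_conj g x : linked x (g * x * g^-1).
Proof.
move=> K KN; split => [/(absorbing_inner g KN)|/(absorbing_inner g^-1 KN)];
  rewrite -innerV -!innerM // invgK !mulgA mulVg mul1g mulgVK//.
Qed.

Lemma linked_fwd (f : local_iso F) x y : dom f x -> dom f y -> linked x y ->
  linked (fwd f x) (fwd f y).
Proof.
move=> fx fy xy K KN; rewrite -!inner_fwd//.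
exact: (xy _ (absorbing_conj (comm_class f) KN)).
Qed.

Section FreeProP.
Variable p : nat.
Hypotheses (p_pr : prime p) (pF : pro_p p F).

Lemma linked_basis (W : set F) (I : finType) (b c : I -> F) i j : open_subgroup W ->
  free_basis p W b -> free_basis p W c -> linked (b i) (b j) -> linked (c i) (c j).
Proof.
move=> oW bb bc; have [f [df fE]] := basis_automorphism p_pr pF oW bb bc.
by rewrite -!fE; apply: linked_fwd; rewrite df; case: bb.
Qed.

(** An automorphism can move one of the two linked elements to any other place of
    the basis while fixing the other one. *)
Lemma linked_basis_all (W : set F) (I : finType) (b : I -> F) i j : open_subgroup W ->
  free_basis p W b -> i <> j -> linked (b i) (b j) -> forall l, linked (b i) (b l).
Proof.
move=> oW bb ij bij l; have [<-//|il] := pselect (i = l).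
have bc : free_basis p W (b \o tperm j l).
  by apply: basis_reindex bb; exists (tperm j l) => z; rewrite tpermK.
have := linked_basis oW bb bc bij; rewrite /= tpermL tpermD//; apply/eqP.
  by move=> /esym.
by move=> /esym.
Qed.

(** An element of [W] whose coordinate at [b None] is nonzero can replace [b None]
    in the basis, and is then linked to [b (Some j)]; such elements generate [W]. *)
Lemma linked_basis_absorbed (W : set F) (J : finType) (b : option J -> F) (j : J) K :
  open_subgroup W -> free_basis p W b -> (forall i, linked (b (Some j)) (b i)) ->
  absorbing K -> K (inner (b (Some j))) -> forall w, W w -> K (inner w).
Proof.
move=> oW bb bL KN Kb; have [phi hphi [phi0 phiS]] := basis_dual p_pr bb.
have [[_ WM _] _] := oW; have [_ KM KV] := KN.1.
have Wb0 : W (b None) by case: bb.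
have main w : W w -> phi w <> 1 -> K (inner w).
  move=> Ww phiw; have bc := basis_replace p_pr pF oW bb hphi phiS Ww phiw.
  have := linked_basis oW bb bc (bL None) KN => /= -[H _]; exact: H.
have Kb0 : K (inner (b None)) by apply/(bL None).
move=> w Ww; have [phiw|/main] := pselect (phi w = 1); last exact.
rewrite -(mulgK (b None) w) innerM innerV; apply: (KM); last exact: KV.
apply: main; first exact: WM.
rewrite hphi.1// phiw mul1g phi0; apply/eqP; exact: GRing.oner_neq0.
Qed.

Section SchreierLinked.
Variables (T : set F) (J : finType) (b : option J -> F) (phi : F -> 'F_p) (j0 : J).
Hypotheses (oT : open_subgroup T) (bb : free_basis p T b) (hphi : hom_on T phi).
Hypotheses (phit : phi (b None) = 1%R) (phib : forall j, phi (b (Some j)) = 1).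

(** The Schreier basis contains [b (Some j0)] and its conjugate by the transversal
    generator [b None], an element of [F]. *)
Lemma schreier_linked i : linked (b (Some j0)) (schreier p b i).
Proof.
have bV := schreier_basis p_pr pF oT bb hphi phit phib.
have oV := hom_on_kernel oT hphi.
have E0 : schreier p b (Some (0%R, j0)) = b (Some j0).
  by rewrite /= expg0 mul1g invg1 mulg1.
rewrite -E0; apply: (linked_basis_all (j := Some (1%R, j0)) oV bV) => //.
by rewrite E0 /= modn_small// expg1; exact: linked_conj.
Qed.

Lemma schreier_absorbed K w : absorbing K -> K (inner (b (Some j0))) ->
  T w -> phi w = 1 -> K (inner w).
Proof.
move=> KN Kb Tw phiw.
have bV := schreier_basis p_pr pF oT bb hphi phit phib.
have oV := hom_on_kernel oT hphi.
apply: (linked_basis_absorbed (j := (0%R, j0)) oV bV) => // [i|].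
- apply: linked_trans (schreier_linked i); apply: linked_sym; exact: schreier_linked.
- by apply/(schreier_linked (Some (0%R, j0))).
Qed.

End SchreierLinked.

Lemma basis_swap T (J : finType) (b : option J -> F) (j : J) : free_basis p T b ->
  free_basis p T (b \o tperm None (Some j)).
Proof.
move=> bb; apply: basis_reindex bb.
by exists (tperm None (Some j)) => z; rewrite tpermK.
Qed.

Hypothesis bF : has_basis p (setT : set F).

(** Let [y] be a basis of [T] for which the kernel [V] of [phi] is the kernel of
    the coordinate of [x = y None], and let [t = y (Some j0)]. In the Schreier basis
    of the kernel of the coordinate of [t], the element [x] is linked to the p-th
    power of [t], which lies in [V], hence in [K]; and [x] and [V] generate [T]. *)
Lemma absorbing_step K T (phi : F -> 'F_p) : absorbing K ->
  open_subgroup T -> hom_on T phi -> (exists2 x, T x & phi x <> 1) ->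
  (forall w, (T `&` [set z | phi z = 1]) w -> K (inner w)) ->
  forall w, T w -> K (inner w).
Proof.
move=> KN oT hphi [x Tx phix] KV.
have [J [b [bb [j0]]]] := open_has_basis p_pr pF bF oT.
have [y [psi [by_ hpsi yx psix [psiy VE]]]] :=
  adapted_schreier p_pr pF oT bb hphi Tx phix.
rewrite {}VE in KV; have [Ty _ _] := by_.
have bs := basis_swap j0 by_.
have [chi hchi [chi0 chiS]] := basis_dual p_pr bs.
have Kx : K (inner x).
  have /= := schreier_linked j0 oT bs hchi chi0 chiS None KN.
  rewrite tpermR tpermL yx => ->; apply: KV.
  have [TX psiX] := hom_onX p oT.1 hpsi (Ty (Some j0)).
  by split => //=; rewrite psiX psiy expg1n.
move=> w Tw; have [_ KM _] := KN.1; have [_ TM TV] := oT.1.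
have [TX psiX] := hom_onX (val (psi w)) oT.1 hpsi Tx.
rewrite -(mulgVK (x ^+ val (psi w)) w) innerM; apply: (KM).
  apply: KV; split=> /=; first by apply: (TM) => //; exact: TV.
  rewrite hpsi.1//; last exact: TV.
  rewrite (hom_onV oT.1 hpsi)// psiX psix FpX natr_Zp.
  exact: mulgV.
elim: (val _) => [|n IH]; first by rewrite expg0 inner1; case: KN.1.
by rewrite expgS innerM; exact: KM.
Qed.

(** A nontrivial element [k] of [K] moves some [u], which gives the nontrivial
    element [k u k^-1 u^-1] of [K] in [F]. It is part of a basis of some open
    subgroup, so [K] absorbs an open subgroup, and then all of [F]. *)
Lemma absorbing_contains_inner K k : absorbing K -> K k -> k <> 1 ->
  forall g, K (inner g).
Proof.
move=> KN Kk k1; have [_ KM KV] := KN.1.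
have [f kE] : exists f, k = comm_class f.
  by exists (generic_quotient.repr k); rewrite comm_class_repr.
have [u du fu] : exists2 u, dom f u & fwd f u <> u.
  apply: contrapT => nu; apply: k1; rewrite kE.
  apply/comm_classP; exists (dom f); split; first exact: dom_open_subgroup.
    by move=> z.
  by move=> z fz; apply: contrapT => ne; apply: nu; exists z.
pose x := fwd f u * u^-1.
have x1 : x <> 1 by move=> /divg1_eq.
have Kx : K (inner x).
  rewrite innerM -inner_fwd// -kE innerV -!mulgA; apply: (KM) => //.
  by rewrite mulgA; apply: absorbing_inner => //; exact: KV.
have [T [phi [oT Tx hphi phix]]] := nontrivial_character p_pr pF x1.
have [J [b [bb [j0]]]] := open_has_basis p_pr pF bF oT.
have [y [psi [by_ hpsi yx psix _]]] := adapted_schreier p_pr pF oT bb hphi Tx phix.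
have bs := basis_swap j0 by_.
have [chi hchi [chi0 chiS]] := basis_dual p_pr bs.
have KW w : (T `&` [set z | chi z = 1]) w -> K (inner w).
  move=> [Tw chiw]; apply: (schreier_absorbed (j0 := j0) oT bs hchi) => //.
  by rewrite /= tpermR yx.
have oW := hom_on_kernel oT hchi.
suff : forall g, setT g -> K (inner g) by move=> H g; exact: H.
pose Q T := forall w, T w -> K (inner w).
apply: (open_subgroup_up p_pr pF (Q := Q) _ oW) => //.
by move=> T' phi' oT' hphi' nphi'; exact: absorbing_step.
Qed.

(** If [t] centralised an open subgroup, it would commute with a p-power of a basis
    element [x]; but [x] and its conjugate by [t] belong to a Schreier basis, so a
    homomorphism to a large cyclic p-group distinguishes their powers. *)
Lemma inner_nontrivial : exists g : F, inner g <> 1.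
Proof.
have [J [b [bb [j0]]]] := bF.
have oT := open_subgroupT F.
have [phi hphi [phi0 phiS]] := basis_dual p_pr bb.
have bV := schreier_basis p_pr pF oT bb hphi phi0 phiS.
exists (b None) => /comm_classP[U [oU _ UE]].
have [N oN NU] := open_normal_sub (pro_p_profinite pF) oU.
have [P [pi [pP piM piK]]] := finite_quotient p_pr pF oN.
have [e Pe] := p_natP pP.
pose n := (p ^ e)%N; pose x := b (Some j0); pose t := b None.
have Ux : U (x ^+ n).
  apply: NU; apply/piK.
  have hpi := quotient_hom_on oN piM piK.
  have [_ ->] := hom_onX n (open_subgroupT F).1 hpi (I : setT x).
  by rewrite /n -Pe; exact: (@expg_cardG _ [set: P]%G _ (finset.in_setT _)).
have tx : t * x ^+ n * t^-1 = x ^+ n by exact: UE.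
have p1 : (1 < p ^ e.+1)%N by rewrite -[1%N](exp1n e.+1) ltn_exp2r ?prime_gt1.
pose Z := 'Z_(p ^ e.+1).
have pZ : p.-group [set: Z]%SET.
  by rewrite /pgroup cardsT card_ord Zp_cast// pnatX pnat_id.
have [V1 fV _] := bV.
have [f hf fE] := fV Z pZ
  (fun i => if i == Some (0%R, j0) then (1%R : Z) else (0%R : Z)).
have oV := hom_on_kernel oT hphi.
have E0 : schreier p b (Some (0%R, j0)) = x by rewrite /= expg0 mul1g invg1 mulg1.
have E1 : schreier p b (Some (1%R, j0)) = t * x * t^-1 by rewrite /= modn_small.
have [_ f0] := hom_onX n oV.1 hf (V1 (Some (0%R, j0))).
have [_ f1] := hom_onX n oV.1 hf (V1 (Some (1%R, j0))).
have txE : (t * x * t^-1) ^+ n = x ^+ n.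
  by have := conjXg x t^-1 n; rewrite /conjg invgK !mulgA tx => <-.
have ZX (z : Z) m : (z ^+ m)%g = (z *+ m)%R.
  by elim: m => [//|m IH]; rewrite expgS IH GRing.mulrS.
have s0 : f (schreier p b (Some (0%R, j0))) = 1%R by rewrite fE eqxx.
have s1 : f (schreier p b (Some (1%R, j0))) = 0%R.
  by rewrite fE; case: eqP => // -[].
move: f1; rewrite s1 E1 txE -E0 f0 s0 !ZX GRing.mul0rn => /(congr1 val).
rewrite /= val_Zp_nat// modn_small; last by rewrite /n ltn_exp2l ?prime_gt1.
by apply/eqP; rewrite -lt0n expn_gt0 prime_gt0.
Qed.
End FreeProP.
End Commensurator.

(** * The monolith *)

Section Monolith.
Variable C : groupType.
Implicit Types N M : set C.

Lemma nontrivial_subgroup N : is_subgroup N -> N <> [set 1] ->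
  exists2 k, N k & k <> 1.
Proof.
move=> [N1 _ _] nN; apply: contrapT => nk; apply: nN; apply/seteqP.
split=> [k Nk|k ->//]; apply: contrapT => k1; apply: nk; by exists k.
Qed.

Lemma monolith_normal : is_normal (monolith C).
Proof.
split=> //; first split => /=.
- by move=> N [[[]]].
- move=> x y Mx My N HN; have [[[_ NM _] _ _] _] := HN.
  by apply: NM; [exact: Mx | exact: My].
- by move=> x Mx N HN; have [[[_ _ NV] _ _] _] := HN; apply: NV; exact: Mx.
- by move=> g x _ Mx N HN; have [[_ _ Nc] _] := HN; apply: Nc => //; exact: Mx.
Qed.

Definition conj_core N : set C := [set k | forall a, N (a * k * a^-1)].

Lemma conj_core_normal N : is_subgroup N -> is_normal (conj_core N).
Proof.
move=> [N1 NM NV]; split => //; first split.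
- by move=> a; rewrite mulg1 mulgV.
- by move=> x y Nx Ny a; have := NM _ _ (Nx a) (Ny a); rewrite !mulgA mulgVK.
- by move=> x Nx a; have := NV _ (Nx a); rewrite !invgM invgK !mulgA.
- by move=> g x _ Nx a; have := Nx (a * g); rewrite !invgM !mulgA.
Qed.

End Monolith.

Theorem theoremG (p : nat) (F : topologicalGroupType) :
  prime p ->
  free_pro_p_of_finite_rank p F ->
  (exists x y : F, x * y <> y * x) ->
  [/\ monolithic (Comm F),
      forall g : F, monolith (Comm F) (inner g) &
      abstractly_simple (monolith (Comm F))].
Proof.
move=> p_pr [n [x fx]] nonab; have pF := fx.1.
have bF := free_has_basis p_pr pF fx nonab.
have absorb (N : set (Comm F)) : absorbing N -> N <> [set 1] -> forall g, N (inner g).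
  move=> aN /(nontrivial_subgroup aN.1)[k Nk k1].
  exact: (absorbing_contains_inner p_pr pF bF aN Nk k1).
have inM g : monolith (Comm F) (inner g).
  move=> N [[sN _ Nc] N1]; apply: absorb => //; split => // a h k Nk.
  exact: Nc.
have [g0 g01] := inner_nontrivial p_pr pF bF.
have M1 : monolith (Comm F) <> [set 1].
  by move=> ME; apply: g01; have := inM g0; rewrite ME.
have [sM _ Mc] := monolith_normal (Comm F).
split => //; split => // N [sN NM Nc].
have [->|N1] := pselect (N = [set 1]); first by left.
right; apply/seteqP; split => //.
have aN : absorbing N.
  split => // a g k Nk; apply: Nc => //; exact: Mc.
suff coreN1 : conj_core N <> [set 1].
  move=> k Mk; have /(_ 1) := Mk (conj_core N) (conj (conj_core_normal sN) coreN1).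
  by rewrite mul1g invg1 mulg1.
have cN g : conj_core N (inner g).
  move=> a; apply: (absorb _ (absorbing_conj a aN)) => E.
  have [k Nk k1] := nontrivial_subgroup sN N1; apply: k1.
  have : [set k | N (a * k * a^-1)] (a^-1 * k * a).
    by rewrite /= !mulgA mulgV mul1g mulgK.
  rewrite E /= => /(congr1 (fun z => a * z * a^-1)).
  by rewrite !mulgA mulgV mul1g mulgK mulg1 mulgV.
by move=> E; apply: g01; have := cN g0; rewrite E.
Qed.
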